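(* Let $\varphi(z)$ be a complex-valued function in the Schur-Agler class on the polydisk $\mathbb{D}^d$. Then for each $z\in\mathbb{D}^d$ and any nonnegative integers $n_1,\dots,n_d$ which are not all zero, $$\left|\frac{\partial^{n}\varphi}{\partial z_d^{n_d}\cdots\partial z_1^{n_1}}(z)\right|\le n_1!\cdots n_d!\;\frac{1-|\varphi(z)|^2}{(1-\|z\|_\infty^2)(1-\|z\|_\infty)^{n-1}},$$ where $n=n_1+\cdots+n_d$.
   Context: Here $d\ge 1$, $\mathbb{D}=\{\zeta\in\mathbb{C}:|\zeta|<1\}$ and $\mathbb{D}^d=\mathbb{D}\times\cdots\times\mathbb{D}$ ($d$ factors). For $z=(z_1,\dots,z_d)\in\mathbb{C}^d$, $\|z\|_\infty=\max_{j=1,\dots,d}|z_j|$. A complex-valued analytic function $\varphi$ on $\mathbb{D}^d$ belongs to the Schur-Agler class on the polydisk if for every tuple $T_1,\dots,T_d$ of commuting contractions on a Hilbert space and every positive number $r<1$, $\|\varphi(rT_1,\dots,rT_d)\|\le 1$ (where $\varphi(rT_1,\dots,rT_d)$ is defined by substituting the operators into the power series of $\varphi$ at the origin). *)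

(* Defs.v *)
(* MathComp and MathComp-Analysis.  The complex field is R[i] with
   R : realType.  The notions that need no real structure are stated for any
   numFieldType K, through which K is a normed space over itself. *)
From HB Require Import structures.
From mathcomp Require Import all_boot all_order all_algebra.
From mathcomp Require Import complex.
From mathcomp Require Import all_classical all_reals all_analysis.
From mathcomp Require summability.

Set Implicit Arguments.
Unset Strict Implicit.
Unset Printing Implicit Defensive.
Import Order.TTheory GRing.Theory Num.Theory.
Import numFieldNormedType.Exports.

Local Open Scope classical_set_scope.
Local Open Scope ring_scope.

Definition multi_index (d : nat) := {ffun 'I_d -> nat}.

Definition polydisk (K : numFieldType) (d : nat) : set 'rV[K]_d :=
  [set z | forall j, `|z 0 j| < 1].
Arguments polydisk : clear implicits.

Definition monomial (K : numFieldType) (d : nat) (z : 'rV[K]_d)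
    (a : multi_index d) : K :=
  \prod_(j < d) z 0 j ^+ a j.

(* Multiple series have no preferred order of summation: convergence is along
   the net of all finite sets of multi-indices (summability.totally). *)
Definition power_series_at (K : numFieldType) (d : nat)
    (phi : 'rV[K]_d -> K) (p : 'rV[K]_d)
    (c : multi_index d -> K) : Prop :=
  \forall z \near nbhs p,
    summability.partial_sum (fun a => c a * monomial (z - p) a) A
      @[A --> summability.totally] --> phi z.

Definition analytic_on_polydisk (K : numFieldType) (d : nat)
    (phi : 'rV[K]_d -> K) : Prop :=
  forall p, polydisk K d p -> exists c, power_series_at phi p c.

Definition partial_derivative (K : numFieldType) (d : nat) (j : 'I_d)
    (f : 'rV[K]_d -> K) : 'rV[K]_d -> K :=
  fun z => 'D_(delta_mx 0 j) f z.

(* enum 'I_d is increasing, so the innermost derivatives are those in the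
   first variable. *)
Definition mixed_derivative (K : numFieldType) (d : nat) (n : multi_index d)
    (f : 'rV[K]_d -> K) : 'rV[K]_d -> K :=
  foldl (fun g j => iter (n j) (partial_derivative j) g) f (enum 'I_d).

(* The norm of a complex normed module is R[i]-valued (and nonnegative), so
   Re only moves it to R.  The supremum is +oo for an unbounded map. *)
Definition operator_norm (R : realType) (H : normedModType R[i])
    (T : H -> H) : \bar R :=
  ereal_sup [set (complex.Re `|T x|)%:E | x in [set x : H | `|x| <= 1]].

Definition operator_monomial (R : realType) (d : nat)
    (H : normedModType R[i]) (S : 'I_d -> H -> H) (a : multi_index d) :
    H -> H :=
  \big[(fun f g => f \o g)/idfun]_(j < d) iter (a j) (S j).

Definition operator_power_series (R : realType) (d : nat)
    (H : normedModType R[i]) (c : multi_index d -> R[i])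
    (S : 'I_d -> H -> H) (B : H -> H) : Prop :=
  operator_norm (fun x =>
      summability.partial_sum (fun a => c a *: operator_monomial S a x) A - B x)
    @[A --> summability.totally] --> (0 : \bar R).

(* The Hilbert spaces are the complete normed modules whose norm comes from a
   positive definite Hermitian form.  B below is phi(r T_1, ..., r T_d). *)
Definition schur_agler (R : realType) (d : nat)
    (phi : 'rV[R[i]]_d -> R[i]) : Prop :=
  analytic_on_polydisk phi /\
  forall c : multi_index d -> R[i], power_series_at phi 0 c ->
  forall (H : completeNormedModType R[i]) (form : {dot H for Num.conj}),
    (forall x : H, `|x| ^+ 2 = form x x) ->
  forall T : 'I_d -> {linear H -> H},
    (forall j, (operator_norm (T j) <= 1)%E) ->
    (forall j k x, T j (T k x) = T k (T j x)) ->
  forall r : R, 0 < r < 1 ->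
  exists B : {linear H -> H},
    operator_power_series c (fun j x => (r%:C)%C *: T j x) B /\
    (operator_norm B <= 1)%E.

(* Main.v *)
(* Let N exceed every n_j, let S be the nilpotent shift of C^N, and let T_j act
   on the j-th factor of the d-fold tensor power of C^N as the image of S under
   the disc automorphism taking 0 to z_j.  The T_j are commuting contractions,
   so B = phi(r T_1, ..., r T_d) is a contraction.  Each T_j is lower triangular
   with constant diagonal z_j, hence the diagonal entries of B all equal
   phi(r z), and compressing B to two basis vectors bounds the relevant
   off-diagonal entries by 1 - |phi(r z)|^2.  Combining the entries of B in the
   row of index n with the coefficients of (1 + conj(z_j) S)^(n_j - 1) isolates
   the n-th Taylor coefficient of phi at r z.  Since z is an arbitrary point of
   the polydisk, replacing it by z / r and letting r tend to 1 gives the bound.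

   The operators also show that the series of phi at 0 converges absolutely on
   the whole polydisk; re-expanding it at nearby points gives an identity
   theorem, by which its sum is phi, and it can be differentiated termwise. *)
Require Import Defs.
From HB Require Import structures.
From mathcomp Require Import all_boot all_order all_algebra.
From mathcomp Require Import complex finmap.
From mathcomp Require Import all_classical all_reals all_analysis.
From mathcomp Require summability.
From mathcomp Require Import ring.

Set Implicit Arguments.
Unset Strict Implicit.
Unset Printing Implicit Defensive.
Import Order.TTheory GRing.Theory Num.Theory.
Import numFieldNormedType.Exports.

Local Open Scope classical_set_scope.
Local Open Scope ring_scope.

(** * Absolutely convergent families *)

(** Origin of the constants: in one variable the combination bounds (1 - |z|^2)^n times the Taylor
    coefficient by 1 - |phi|^2 times the l1 norm of the coefficients of (1 + conj(z) S)^(n - 1),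
    which is at most (1 + |z|)^(n - 1). Since 1 - |z|^2 = (1 - |z|)(1 + |z|), dividing leaves (1 -
    |z|^2)(1 - |z|)^(n - 1). In several variables these factors multiply; one variable keeps its
    factor 1 - |z_j|^2, and the others weaken it to 1 - |z_j|, which gives the total exponent n - 1.

    The power n_j - 1 has degree below n_j in S. Hence the diagonal entry of B, to which the bound 1
    - |phi|^2 does not apply, never enters the combination.

    In the limit the point z stays fixed and the operators are built at w = z / r. The Taylor data
    at r w = z are then independent of r, so letting r tend to 1 only concerns a polynomial
    inequality in r. *)

Lemma partial_sumE (I : choiceType) (V : zmodType) (u : I -> V) (A : {fset I}) :
  summability.partial_sum u A = \sum_(i <- A) u i.
Proof. by rewrite /summability.partial_sum (big_seq_fsetE _ _ predT). Qed.

Section Families.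
Context {K : numFieldType} {I : choiceType}.
Implicit Types (u v : I -> K) (s t : K) (A B : {fset I}).

Definition has_sum u s :=
  forall e : K, 0 < e ->
    exists A, forall B, (A `<=` B)%fset -> `|s - \sum_(i <- B) u i| < e.

(* Cauchy form of absolute convergence: it passes to smaller families without
   any appeal to suprema. *)
Definition abs_cvg u :=
  forall e : K, 0 < e ->
    exists A, forall B, [disjoint A & B]%fset -> \sum_(i <- B) `|u i| < e.

Lemma has_sumP u s :
  summability.partial_sum u A @[A --> summability.totally] --> s <-> has_sum u s.
Proof.
have FF : ProperFilter (@summability.totally I) := summability.totally_filter.
split.
  move=> /cvgrPdist_lt h e e0; have [A _ hA] := h e e0.
  by exists A => B AB; rewrite -partial_sumE; apply: hA.
move=> h; apply/cvgrPdist_lt => e e0; have [A hA] := h e e0.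
by exists A => // B /= AB; rewrite partial_sumE; apply: hA.
Qed.

Lemma eq_has_sum u v s : u =1 v -> has_sum u s -> has_sum v s.
Proof.
by move=> /funext ->.
Qed.

Lemma has_sum_unique u s t : has_sum u s -> has_sum u t -> s = t.
Proof.
have FF : ProperFilter (@summability.totally I) := summability.totally_filter.
move=> /has_sumP us /has_sumP ut; exact: norm_cvg_unique us ut.
Qed.

Lemma has_sumD u v s t :
  has_sum u s -> has_sum v t -> has_sum (fun i => u i + v i) (s + t).
Proof.
move=> us vt e e0; have e2 : 0 < e / 2 by rewrite divr_gt0.
have [A hA] := us _ e2; have [B hB] := vt _ e2.
exists (A `|` B)%fset => D; rewrite fsubUset => /andP[AD BD].
rewrite big_split/= opprD addrACA (splitr e).
exact: le_lt_trans (ler_normD _ _) (ltrD (hA _ AD) (hB _ BD)).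
Qed.

Lemma has_sumZ (k : K) u s : has_sum u s -> has_sum (fun i => k * u i) (k * s).
Proof.
move=> us e e0; have [->|k0] := eqVneq k 0.
  exists fset0 => B _; rewrite mul0r big1 ?subr0 ?normr0// => i _.
  by rewrite mul0r.
have k1 : 0 < `|k| by rewrite normr_gt0.
have [A hA] := us (e / `|k|) (divr_gt0 e0 k1).
exists A => B AB; rewrite -mulr_sumr -mulrBr normrM mulrC -ltr_pdivlMr//.
exact: hA.
Qed.

Lemma has_sum0 : has_sum (fun=> 0) 0.
Proof. by move=> e e0; exists fset0 => B _; rewrite big1// subr0 normr0. Qed.

Lemma has_sum_sum (J : Type) (r : seq J) (u : J -> I -> K) (s : J -> K) :
  (forall j, has_sum (u j) (s j)) ->
  has_sum (fun i => \sum_(j <- r) u j i) (\sum_(j <- r) s j).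
Proof.
move=> us; elim: r => [|j r IH].
  by rewrite big_nil; apply: eq_has_sum has_sum0 => i; rewrite big_nil.
rewrite big_cons; apply: eq_has_sum (has_sumD (us j) IH) => i.
by rewrite big_cons.
Qed.

Lemma has_sum_fset u A :
  (forall i, i \notin A -> u i = 0) -> has_sum u (\sum_(i <- A) u i).
Proof.
move=> u0 e e0; exists A => B AB.
by rewrite (big_fset_incl _ AB) ?subrr ?normr0// => i _; apply: u0.
Qed.

Lemma norm_has_sum_le u s M :
  has_sum u s -> (forall A, `|\sum_(i <- A) u i| <= M) -> `|s| <= M.
Proof.
move=> us uM; apply/ler_addgt0Pr => e e0; have [A hA] := us e e0.
rewrite -[s](subrK (\sum_(i <- A) u i)) addrC.
by rewrite (le_trans (ler_normD _ _))// lerD// ltW// hA.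
Qed.

(** Since the terms in [D] vanish, every partial sum equals one over a set disjoint from [D]; a tail
    estimate thus bounds the whole sum. *)
Lemma norm_has_sum_le_out u s M D :
  has_sum u s -> (forall i, i \in D -> u i = 0) ->
  (forall B, [disjoint D & B]%fset -> `|\sum_(i <- B) u i| <= M) -> `|s| <= M.
Proof.
move=> us u0 uM; apply: (norm_has_sum_le us) => B.
rewrite -(@big_fset_incl _ _ _ _ (B `\` D)%fset B) ?fsubsetDl//.
  by apply: uM; apply/fdisjointP => i iD; rewrite inE iD.
by move=> i iB; rewrite inE iB andbT negbK; apply: u0.
Qed.

Lemma abs_cvg_le u v :
  (forall i, `|u i| <= `|v i|) -> abs_cvg v -> abs_cvg u.
Proof.
move=> uv hv e e0; have [A hA] := hv e e0; exists A => B AB.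
by apply: le_lt_trans (hA B AB); apply: ler_sum.
Qed.

Lemma abs_cvgZ (k : K) u : abs_cvg u -> abs_cvg (fun i => k * u i).
Proof.
move=> hu e e0; have [->|k0] := eqVneq k 0.
  by exists fset0 => B _; rewrite big1// => i _; rewrite mul0r normr0.
have k1 : 0 < `|k| by rewrite normr_gt0.
have [A hA] := hu (e / `|k|) (divr_gt0 e0 k1); exists A => B AB.
under eq_bigr do rewrite normrM.
by rewrite -mulr_sumr mulrC -ltr_pdivlMr//; apply: hA.
Qed.

Lemma abs_cvgD u v : abs_cvg u -> abs_cvg v -> abs_cvg (fun i => u i + v i).
Proof.
move=> hu hv e e0; have e2 : 0 < e / 2 by rewrite divr_gt0.
have [A hA] := hu _ e2; have [B hB] := hv _ e2.
exists (A `|` B)%fset => D; rewrite fdisjointUX => /andP[AD BD].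
rewrite (splitr e); apply: le_lt_trans (ltrD (hA _ AD) (hB _ BD)).
by rewrite -big_split/=; apply: ler_sum => i _; apply: ler_normD.
Qed.

Lemma abs_cvg_bounded u : abs_cvg u ->
  exists2 M, 0 <= M & forall A, \sum_(i <- A) `|u i| <= M.
Proof.
move=> /(_ 1 ltr01)[A hA]; exists (\sum_(i <- A) `|u i| + 1).
  by rewrite addr_ge0 ?sumr_ge0.
move=> B; rewrite (big_fsetID _ (mem A))/=; apply: lerD.
  rewrite [leRHS](big_fsetID _ (mem B))/= -[leLHS]addr0 lerD ?sumr_ge0//.
  rewrite le_eqVlt (_ : [fset x in B | x \in A] = [fset x in A | x \in B])%fset ?eqxx//.
  by apply/fsetP => x; rewrite !inE andbC.
apply/ltW/hA; apply/fdisjointP => x xA; rewrite !inE xA andbF//.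
Qed.

End Families.

(** * Completeness of the complex field and absolute convergence *)

Section ComplexNumbers.
Context {R : realType}.
Implicit Types x : R[i].

Lemma norm_real_complex (r : R) : `|r%:C%C| = `|r|%:C%C :> R[i].
Proof. by rewrite normc_def/= expr0n/= addr0 sqrtr_sqr. Qed.

Lemma norm_imaginary_unit : `|'i%C| = 1 :> R[i].
Proof. by rewrite normc_def/= expr0n/= add0r expr1n sqrtr1. Qed.

Lemma norm_Im_le x : `|complex.Im x|%:C%C <= `|x|.
Proof.
case: x => a b; rewrite normc_def lecR/= -sqrtr_sqr ler_sqrt ?addr_ge0 ?sqr_ge0//.
by rewrite lerDr sqr_ge0.
Qed.

Lemma ge0_ReE x : 0 <= x -> x = (complex.Re x)%:C%C.
Proof. by move=> x0; rewrite RRe_real// ger0_real. Qed.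

Lemma ltc1 (r : R) : (r%:C%C < 1 :> R[i]) = (r < 1).
Proof. exact: (ltcR r 1). Qed.

Lemma lec1 (r : R) : (r%:C%C <= 1 :> R[i]) = (r <= 1).
Proof. exact: (lecR r 1). Qed.

Lemma gt0_Re x : 0 < x -> 0 < complex.Re x.
Proof. by rewrite ltcE/= => /andP[]. Qed.

End ComplexNumbers.

(** The order of [K] is only partial; a minimum of two radii comes from the comparability of
    positive elements. *)
Lemma exists_pos_le2 (K : numFieldType) (a b : K) :
  0 < a -> 0 < b -> exists e, [/\ 0 < e, e <= a & e <= b].
Proof.
move=> a0 b0; have cmp : (a >=< b)%R by apply: real_comparable; apply: gtr0_real.
have [h|h] := comparable_leP cmp; first by exists a.
by exists b; split=> //; apply: ltW.
Qed.

Section ComplexFamilies.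
Context {R : realType}.
Local Notation C := (R[i] : numFieldType).

(** Real and imaginary part are additive and do not increase the norm, so they carry [F] to Cauchy
    filters on [R]; the two limits are the coordinates of the limit. *)
Lemma complex_complete (F : set_system C) :
  ProperFilter F -> cauchy F -> exists l : C, F --> l.
Proof.
move=> FF /cauchyP Fc.
have key (p : R[i] -> R) : (forall z w, p (z - w) = p z - p w) ->
    (forall z, `|p z|%:C%C <= `|z|) ->
    exists l : R, (p : C -> R) @ F --> l.
  move=> pB pn.
  suff : cauchy ((p : C -> R) @ F).
    by move=> /(@R_complete R _ (fmap_proper_filter (p : C -> R) FF)) /cvg_ex.
  apply/cauchyP => e e0; have e0' : 0 < (e%:C)%C :> C by rewrite ltcR.
  have [x Fx] := Fc _ e0'; exists (p x).
  change (F ((p : C -> R) @^-1` ball (p x) e)); apply: filterS Fx => y.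
  rewrite -ball_normE/= => h; change (`|p x - p y| < e).
  by rewrite -pB -ltcR; apply: le_lt_trans h.
have [a ha] := key _ (fun z w => raddfB (@complex.Re R) z w) (@normc_ge_Re R).
have [b hb] := key _ (fun z w => raddfB (@complex.Im R) z w) norm_Im_le.
exists (a +i* b)%C; apply/cvgrPdist_lt => e e0.
have e2 : 0 < complex.Re e / 2 by rewrite divr_gt0// gt0_Re.
have eE := ge0_ReE (ltW e0).
move/cvgrPdist_lt/(_ _ e2): ha; move/cvgrPdist_lt/(_ _ e2): hb.
apply: filterS2 => x; move: x => [x y]/= hy hx.
rewrite eE [complex.Re e]splitr.
have -> : (a +i* b)%C - (x +i* y)%C = (a - x)%:C%C + 'i%C * (b - y)%:C%C :> R[i].
  by rewrite [LHS]complexE.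
apply: le_lt_trans (ler_normD _ _) _; rewrite normrM [ltRHS]rmorphD/=.
by rewrite norm_imaginary_unit mul1r !norm_real_complex ltrD// ltcR.
Qed.

Lemma abs_cvg_has_sum (I : choiceType) (u : I -> C) :
  abs_cvg u -> exists s, has_sum u s.
Proof.
move=> hu.
have FF : ProperFilter (@summability.totally I) := summability.totally_filter.
suff [l hl] : exists l : C,
    summability.partial_sum u A @[A --> summability.totally] --> l.
  by exists l; apply/has_sumP.
apply: complex_complete; apply/cauchyP => e e0.
have [A hA] := hu e e0; exists (summability.partial_sum u A).
exists A => // B /= AB; rewrite -ball_normE/= !partial_sumE.
have -> : \sum_(i <- B) u i = \sum_(i <- A) u i + \sum_(i <- (B `\` A)%fset) u i.
  rewrite (big_fsetID _ (mem A) B)/=; congr (_ + _); apply: eq_fbigl => i.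
    by rewrite !inE andbC; apply: andb_idr; apply: fsubsetP.
  by rewrite !inE andbC.
rewrite opprD addrA subrr add0r normrN (le_lt_trans (ler_norm_sum _ _ _))// hA//.
by apply/fdisjointP => i iA; rewrite inE iA.
Qed.

(** Finite sums away from a large [A] are small. Splitting such an index set by the sign of the real
    part, then of the imaginary part, turns sums of absolute values into absolute values of sums. *)
Lemma has_sum_abs_cvg (I : choiceType) (u : I -> C) s :
  has_sum u s -> abs_cvg u.
Proof.
move=> us e e0.
(* Two errors of e / 16 give e / 8 for a finite sum off [A], the two signs give e / 4, and the two
   parts add up to e / 2. *)
have e8 : 0 < e / 16 by rewrite divr_gt0.
have [A hA] := us _ e8; exists A => B AB.
have small D : [disjoint A & D]%fset -> `|\sum_(i <- D) u i| < e / 8.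
  move=> AD.
  have -> : \sum_(i <- D) u i = (s - \sum_(i <- A) u i) -
      (s - \sum_(i <- (A `|` D)%fset) u i).
    rewrite (_ : \sum_(i <- (A `|` D)%fset) u i =
        \sum_(i <- A) u i + \sum_(i <- D) u i); last first.
      rewrite (big_fsetID _ (mem A))/=; congr (_ + _); apply: eq_fbigl => i.
        by rewrite !inE; case: (i \in A) => //=; rewrite andbF.
      rewrite !inE; have [iA|] := boolP (i \in A) => /=; last by rewrite andbT.
      by rewrite (negbTE (fdisjointP AD _ iA)).
    by rewrite opprB addrC addrA subrK addrAC subrr add0r.
  have -> : e / 8 = e / 16 + e / 16 by field.
  by rewrite (le_lt_trans (ler_normB _ _))// ltrD// hA ?fsubsetUl.
have part (p : R[i] -> R) (D : {fset I}) :
    (forall z, `|p z|%:C%C <= `|z|) -> (forall z w, p (z + w) = p z + p w) ->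
    p 0 = 0 -> [disjoint A & D]%fset ->
  (`|\sum_(i <- D) p (u i)|)%:C%C < e / 8 :> R[i].
  move=> pn pD p0 AD; apply: le_lt_trans (small _ AD).
  by rewrite -(big_morph p pD p0) pn.
have half (p : R[i] -> R) :
    (forall z, `|p z|%:C%C <= `|z|) -> (forall z w, p (z + w) = p z + p w) ->
    p 0 = 0 -> (\sum_(i <- B) `|p (u i)|)%:C%C < e / 4 :> R[i].
  move=> pn pD p0.
  rewrite (big_fsetID _ [pred i | 0 <= p (u i)])/=.
  have -> : \sum_(i <- [fset x in B | 0 <= p (u x)]%fset) `|p (u i)| =
            `|\sum_(i <- [fset x in B | 0 <= p (u x)]%fset) p (u i)|.
    rewrite ger0_norm; last first.
      by rewrite big_seq sumr_ge0// => i; rewrite !inE/= => /andP[].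
    by rewrite big_seq [RHS]big_seq; apply: eq_bigr => i; rewrite !inE/= => /andP[_ /ger0_norm].
  have -> : \sum_(i <- [fset x in B | ~~ (0 <= p (u x))]%fset) `|p (u i)| =
            `|\sum_(i <- [fset x in B | ~~ (0 <= p (u x))]%fset) p (u i)|.
    rewrite ler0_norm; last first.
      rewrite big_seq sumr_le0// => i; rewrite !inE/= => /andP[_].
      by rewrite -ltNge => /ltW.
    rewrite -sumrN big_seq [RHS]big_seq; apply: eq_bigr => i; rewrite !inE/= => /andP[_].
    by rewrite -ltNge => /ltr0_norm.
  have -> : e / 4 = e / 8 + e / 8 by field.
  rewrite rmorphD/= ltrD// part//;
    by apply/fdisjointP => i /(fdisjointP AB) iB; rewrite !inE/= (negbTE iB).
have h1 := half _ (@normc_ge_Re R) (raddfD (@complex.Re R)) erefl.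
have h2 := half _ norm_Im_le (raddfD (@complex.Im R)) erefl.
apply: (@le_lt_trans _ _ ((\sum_(i <- B) `|complex.Re (u i)|)%:C%C +
                     (\sum_(i <- B) `|complex.Im (u i)|)%:C%C)).
  rewrite !rmorph_sum -big_split/=; apply: ler_sum => i _.
  rewrite {1}[u i]complexE (le_trans (ler_normD _ _))// normrM.
  by rewrite norm_imaginary_unit mul1r !norm_real_complex.
apply: lt_trans (ltrD h1 h2) _; rewrite -mulrDl -mulr2n ltr_pdivrMr//.
by rewrite -[e *+ 2]mulr_natr ltr_pM2l// ltr_nat.
Qed.

End ComplexFamilies.

(** * Power series in several variables *)

Section Binomial.
Context {K : numFieldType}.

Lemma binomial_term_le (x y : K) (a m : nat) : 0 <= x -> 0 <= y ->
  'C(a, m)%:R * x ^+ (a - m) * y ^+ m <= (x + y) ^+ a.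
Proof.
move=> x0 y0; have [am|ma] := ltnP a m.
  by rewrite bin_small// !mul0r exprn_ge0// addr_ge0.
rewrite exprDn (bigD1 (inord m : 'I_a.+1))//= inordK// -mulrA mulr_natl lerDl.
by rewrite sumr_ge0// => i _; rewrite mulrn_wge0// mulr_ge0// exprn_ge0.
Qed.

(** A range [N] independent of the exponent (the extra binomials vanish) gives all factors of a
    monomial the same index type. *)
Lemma exprDn_wide (x y : K) (a N : nat) : (a < N)%N ->
  (x + y) ^+ a = \sum_(i < N) 'C(a, i)%:R * x ^+ (a - i) * y ^+ i.
Proof.
move=> aN; rewrite exprDn.
rewrite (big_ord_widen N (fun i => x ^+ (a - i) * y ^+ i *+ 'C(a, i)))//.
rewrite [RHS](bigID (fun i : 'I_N => (i < a.+1)%N))/= [X in _ = _ + X]big1 ?addr0.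
  by apply: eq_bigr => i _; rewrite -mulrA mulr_natl.
by move=> i; rewrite -leqNgt => ai; rewrite bin_small// !mul0r.
Qed.

(** Every term of order i >= 2 satisfies |h|^i <= (|h| / D)^2 D^i. The bound depends on [p] only
    through a power, so it can be summed against the coefficients of a power series. *)
Lemma norm_taylor1_le (x h D : K) (p : nat) : 0 < D -> `|h| <= D ->
  `|(x + h) ^+ p - x ^+ p - p%:R * x ^+ p.-1 * h| <=
  (`|h| / D) ^+ 2 * (`|x| + D) ^+ p.
Proof.
move=> D0 hD.
have -> : (x + h) ^+ p - x ^+ p - p%:R * x ^+ p.-1 * h =
    \sum_(i < p.+2 | (1 < i)%N) 'C(p, i)%:R * x ^+ (p - i) * h ^+ i.
  rewrite (@exprDn_wide _ _ _ p.+2)//.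
  rewrite big_ord_recl big_ord_recl/= bin0 subn0 expr0 mulr1 mul1r bin1 subn1 expr1.
  rewrite [RHS]big_mkcond/= !big_ord_recl/= !add0r.
  by set S := \sum_(i < p) _; ring.
apply: le_trans (ler_norm_sum _ _ _) _.
rewrite (@exprDn_wide _ _ _ p.+2)// mulr_sumr.
rewrite [leRHS](bigID (fun i : 'I_p.+2 => (1 < i)%N))/= -[leLHS]addr0 lerD//; last first.
  rewrite sumr_ge0// => i _.
  by rewrite !mulr_ge0 ?invr_ge0 ?exprn_ge0 ?divr_ge0 ?ler0n ?normr_ge0 ?(ltW D0).
apply: ler_sum => i i1.
rewrite !normrM normr_nat !normrX mulrCA; apply: ler_wpM2l.
  by rewrite mulr_ge0 ?ler0n ?exprn_ge0.
rewrite -(subnKC i1) !exprD mulrA -exprMn divfK ?gt_eqF// ler_wpM2l ?exprn_ge0//.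
by apply: lerXn2r; rewrite ?nnegrE ?(ltW D0).
Qed.

End Binomial.

Section BinomialMonomial.
Context {K : numFieldType} {d : nat}.
Implicit Types (a m : multi_index d) (w k : 'rV[K]_d).

(* The derivative of the monomial of exponent a of order m, divided by m!. *)
Definition bin_monomial a m w : K :=
  \prod_(j < d) ('C(a j, m j)%:R * w 0 j ^+ (a j - m j)).

Lemma bin_monomial0 a w : bin_monomial a [ffun=> 0%N] w = monomial w a.
Proof. by apply: eq_bigr => j _; rewrite ffunE bin0 mul1r subn0. Qed.

Lemma norm_bin_monomial a m w :
  `|bin_monomial a m w| = bin_monomial a m (\row_j `|w 0 j|).
Proof.
rewrite normr_prod; apply: eq_bigr => j _.
by rewrite normrM normr_nat normrX mxE.
Qed.

Lemma bin_monomial_ge0 a m w : (forall j, 0 <= w 0 j) -> 0 <= bin_monomial a m w.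
Proof. by move=> w0; apply: prodr_ge0 => j _; rewrite mulr_ge0 ?ler0n ?exprn_ge0. Qed.

Lemma bin_monomial_diag a w : bin_monomial a a w = 1.
Proof. by rewrite /bin_monomial big1// => j _; rewrite binn subnn expr0 mulr1. Qed.

Lemma bin_monomial_at0 a m : a != m -> bin_monomial a m (0 : 'rV[K]_d) = 0.
Proof.
move=> am; have [j jam] : exists j, a j != m j.
  apply/existsP; rewrite -negb_forall; apply: contra am => /forallP am.
  by apply/eqP/ffunP => j; apply/eqP.
rewrite /bin_monomial (bigD1 j)//= mxE.
have [lt|gt|eq] := ltngtP (a j) (m j); last by rewrite eq eqxx in jam.
  by rewrite bin_small// !mul0r.
by rewrite expr0n subn_eq0 leqNgt gt/= mulr0 mul0r.
Qed.

Lemma bin_monomial_le a m w k :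
  (forall j, 0 <= w 0 j) -> (forall j, 0 <= k 0 j) ->
  bin_monomial a m w * monomial k m <= monomial (w + k) a.
Proof.
move=> w0 k0; rewrite -big_split/=; apply: ler_prod => j _.
rewrite mxE binomial_term_le// andbT.
by rewrite !mulr_ge0 ?ler0n ?exprn_ge0.
Qed.

(** [M] contains the support of the expansion, so the identity persists over any larger finite set
    of exponents. *)
Lemma binomial_monomial a : exists M : {fset multi_index d},
  (forall m, m \notin M -> forall w, bin_monomial a m w = 0) /\
  forall w k,
    \sum_(m <- M) bin_monomial a m w * monomial k m = monomial (w + k) a.
Proof.
pose N := (\sum_j a j).+1.
have aN j : (a j < N)%N by rewrite ltnS (bigD1 j)//= leq_addr.
pose f (b : {ffun 'I_d -> 'I_N}) : multi_index d := [ffun j => nat_of_ord (b j)].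
have fI : injective f.
  move=> b b' /ffunP bb'; apply/ffunP => j; apply/val_inj.
  by have := bb' j; rewrite !ffunE.
exists [fset f b | b in {: {ffun 'I_d -> 'I_N}}]%fset; split.
  move=> m mM w; have [j mj] : exists j, (N <= m j)%N.
    apply/existsP; rewrite -[X in is_true X]negbK negb_exists; apply: contra mM => /forallP mM.
    apply/imfsetP; exists [ffun j => inord (m j)] => //.
    apply/ffunP => j; rewrite !ffunE inordK//.
    by have := mM j; rewrite -ltnNge.
  by rewrite /bin_monomial (bigD1 j)//= bin_small ?(leq_trans (aN j))// !mul0r.
move=> w k; rewrite big_imfset/=; last by move=> ? ? _ _; apply: fI.
rewrite big_enum/=.
under eq_bigr do rewrite /bin_monomial /monomial -big_split/=.
transitivity (\sum_(b : {ffun 'I_d -> 'I_N}) \prod_(j < d)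
  ('C(a j, b j)%:R * w 0 j ^+ (a j - b j) * k 0 j ^+ b j)).
  by apply: eq_bigr => b _; apply: eq_bigr => j _; rewrite ffunE.
rewrite -(bigA_distr_bigA (fun j (i : 'I_N) => 'C(a j, i)%:R * w 0 j ^+ (a j - i) * k 0 j ^+ i)).
by apply: eq_bigr => j _; rewrite mxE (exprDn_wide _ _ (aN j)).
Qed.

End BinomialMonomial.

Section RowNorm.
Context {K : numFieldType} {d : nat}.

(** The clause [0 < M] carries the case d = 0, where no coordinate bounds [M] from below. *)
Lemma row_norm_ltP (w : 'rV[K]_d) (M : K) :
  `|w| < M <-> 0 < M /\ forall j, `|w 0 j| < M.
Proof.
have -> : is_true (`|w| < M) = ball_ (fun x : 'rV[K]_d => `|x|) 0 M w.
  by rewrite /ball_/= sub0r normrN.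
rewrite -mx_norm_ball; split=> -[M0 h]; split=> //.
  by move=> j; have := h 0 j; rewrite -ball_normE/= mxE sub0r normrN.
by move=> i j; rewrite -ball_normE/= mxE sub0r normrN (ord1 i).
Qed.

Lemma row_norm_ge (w : 'rV[K]_d) j : `|w 0 j| <= `|w|.
Proof.
apply/ler_addgt0Pr => e e0; apply/ltW.
by have /row_norm_ltP[_] : `|w| < `|w| + e by rewrite ltrDl.
Qed.

Lemma row_norm_le (w : 'rV[K]_d) (M : K) :
  0 <= M -> (forall j, `|w 0 j| <= M) -> `|w| <= M.
Proof.
move=> M0 h; apply/ler_addgt0Pr => e e0; apply/ltW/row_norm_ltP.
by split=> [|j]; [rewrite ltr_wpDl | rewrite (le_lt_trans (h j))// ltrDl].
Qed.

End RowNorm.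

Section PowerSeries.
Context {R : realType} {d : nat}.
Local Notation C := (R[i] : numFieldType).
Implicit Types (c : multi_index d -> C) (m : multi_index d) (w k p : 'rV[C]_d).

Definition abs_cvg_ball c (r : C) :=
  forall w, `|w| < r -> abs_cvg (fun a => c a * monomial w a).

(* The Taylor coefficient of order m at w of the sum of the series c (junk if
   the series diverges). *)
Definition taylor_coef c m w : C :=
  xget 0 [set s | has_sum (fun a => c a * bin_monomial a m w) s].

Lemma polyradius_room (r : C) w : `|w| < r ->
  exists2 D, 0 < D & `|\row_j (`|w 0 j| + D) : 'rV[C]_d| < r.
Proof.
move=> wr; exists ((r - `|w|) / 2); first by rewrite divr_gt0// subr_gt0.
have D0 : 0 < (r - `|w|) / 2 by rewrite divr_gt0// subr_gt0.
apply/row_norm_ltP; split=> [|j]; first exact: le_lt_trans wr.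
rewrite mxE ger0_norm ?addr_ge0 ?(ltW D0)//.
apply: (@le_lt_trans _ _ (`|w| + (r - `|w|) / 2)); first by rewrite lerD2r row_norm_ge.
by rewrite -ltrBrDl ltr_pdivrMr// ltr_pMr ?subr_gt0// ltr1n.
Qed.

(* Enlarging the polyradius by D turns derivatives into powers of D^-1. *)
Lemma norm_bin_monomial_le (D : C) a m w : 0 < D ->
  `|bin_monomial a m w| <=
  \prod_j D ^- (m j) * monomial (\row_j (`|w 0 j| + D)) a.
Proof.
move=> D0; rewrite norm_bin_monomial.
have k0 : 0 < monomial (\row_(j < d) D) m.
  by apply: prodr_gt0 => j _; rewrite mxE exprn_gt0.
have -> : \prod_j D ^- m j = (monomial (\row_(j < d) D) m)^-1.
  by rewrite -prodfV; apply: eq_bigr => j _; rewrite mxE.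
rewrite mulrC ler_pdivlMr//.
apply: le_trans (bin_monomial_le _ _ _ _) _ => [j|j|]; rewrite ?mxE ?(ltW D0)//.
rewrite le_eqVlt; apply/orP; left; apply/eqP; congr monomial.
by apply/rowP => j; rewrite !mxE.
Qed.

Lemma abs_cvg_taylor c (r : C) m w : abs_cvg_ball c r -> `|w| < r ->
  abs_cvg (fun a => c a * bin_monomial a m w).
Proof.
move=> cr wr; have [D D0 hD] := polyradius_room wr.
apply: abs_cvg_le (abs_cvgZ (\prod_j D ^- (m j)) (cr _ hD)) => a.
rewrite !normrM mulrCA ler_wpM2l//.
have h := norm_bin_monomial_le a m w D0; rewrite (le_trans h)//.
by rewrite -normrM real_ler_norm// ger0_real// (le_trans _ h).
Qed.

Lemma has_sum_taylor c (r : C) m w : abs_cvg_ball c r -> `|w| < r ->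
  has_sum (fun a => c a * bin_monomial a m w) (taylor_coef c m w).
Proof.
move=> cr wr; have [s hs] := abs_cvg_has_sum (abs_cvg_taylor m cr wr).
exact: (@xgetPex _ 0 [set s | has_sum (fun a => c a * bin_monomial a m w) s]
          (ex_intro _ s hs)).
Qed.

Lemma taylor_coefE c m w s :
  has_sum (fun a => c a * bin_monomial a m w) s -> taylor_coef c m w = s.
Proof.
move=> hs; apply: (has_sum_unique _ hs).
exact: (@xgetPex _ 0 [set s | has_sum (fun a => c a * bin_monomial a m w) s]
          (ex_intro _ s hs)).
Qed.

Lemma taylor_coef_at0 c m : taylor_coef c m 0 = c m.
Proof.
apply: taylor_coefE.
have := @has_sum_fset _ _ (fun a => c a * bin_monomial a m 0) [fset m]%fset.
rewrite big_seq_fset1 bin_monomial_diag mulr1; apply=> a.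
by rewrite inE => am; rewrite bin_monomial_at0// mulr0.
Qed.

Definition incr j m : multi_index d := [ffun i => (m i + (i == j))%N].

(** Only the j-th factor moves, and [norm_taylor1_le] applies to it; the others are bounded at the
    enlarged polyradius. The linear term has the stated form because (a_j - m_j) C(a_j, m_j) = (m_j
    + 1) C(a_j, m_j + 1). *)
Lemma bin_monomial_taylor1 (D h : C) a m j w : 0 < D -> `|h| <= D ->
  `|bin_monomial a m (w + h *: delta_mx 0 j) - bin_monomial a m w -
    h * (m j).+1%:R * bin_monomial a (incr j m) w| <=
  (`|h| / D) ^+ 2 * bin_monomial a m (\row_i (`|w 0 i| + D)).
Proof.
move=> D0 hD.
pose P (v : 'rV[C]_d) : C := \prod_(i < d | i != j) ('C(a i, m i)%:R * v 0 i ^+ (a i - m i)).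
have e1 : bin_monomial a m (w + h *: delta_mx 0 j) =
    'C(a j, m j)%:R * (w 0 j + h) ^+ (a j - m j) * P w.
  rewrite /bin_monomial (bigD1 j)//= !mxE !eqxx mulr1; congr (_ * _).
  by apply: eq_bigr => i ij; rewrite !mxE (negbTE ij) andbF mulr0 addr0.
have e2 v : bin_monomial a m v = 'C(a j, m j)%:R * v 0 j ^+ (a j - m j) * P v.
  by rewrite /bin_monomial (bigD1 j).
have e3 : (m j).+1%:R * bin_monomial a (incr j m) w =
    'C(a j, m j)%:R * ((a j - m j)%:R * w 0 j ^+ (a j - m j).-1) * P w.
  rewrite /bin_monomial (bigD1 j)//= ffunE eqxx addn1 [LHS]mulrA; congr (_ * _).
    by rewrite subnS !mulrA -!natrM mul_bin_left mulnC.
  by apply: eq_bigr => i ij; rewrite ffunE (negbTE ij) addn0.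
rewrite -[h * _ * _]mulrA e3 e1 !e2 mxE.
have -> : forall b x y z q : C,
   b * x * q - b * y * q - h * (b * z * q) = b * (x - y - z * h) * q.
  by move=> b x y z q; ring.
rewrite !normrM normr_nat.
have Pw : `|P w| <= P (\row_i (`|w 0 i| + D)).
  rewrite normr_prod; apply: ler_prod => i _; rewrite normr_ge0/= normrM normr_nat.
  rewrite ler_wpM2l// mxE normrX lerXn2r ?nnegrE ?addr_ge0 ?(ltW D0)//.
  by rewrite lerDl ltW.
rewrite [leRHS]mulrA; apply: ler_pM; rewrite ?mulr_ge0 ?normr_ge0 ?ler0n//.
by rewrite mulrCA ler_wpM2l// norm_taylor1_le.
Qed.

(** Summing the second-order remainders costs at most (|h| / D)^2 times a bound [M] for the series
    at the enlarged polyradius, so the error of the difference quotient is O(|h|). *)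
Lemma is_derive_taylor_coef c (r : C) m j w : abs_cvg_ball c r -> `|w| < r ->
  is_derive w (delta_mx 0 j) (taylor_coef c m)
    ((m j).+1%:R * taylor_coef c (incr j m) w).
Proof.
move=> cr wr; have [D D0 hD] := polyradius_room wr.
set L := _.+1%:R * _.
suff hL : (fun h => h^-1 *: ((taylor_coef c m \o shift w)
    (h *: (delta_mx 0 j : 'rV[C]_d)) - taylor_coef c m w)) @ 0^' --> L.
  by split; [apply/cvg_ex; exists L | apply: cvg_lim].
have dv (h : C) : `|h *: delta_mx 0 j : 'rV[C]_d| <= `|h|.
  apply: row_norm_le => // i; rewrite !mxE eqxx/=.
  by case: (i == j); rewrite ?mulr1// mulr0 normr0.
have [M M0 hM] := abs_cvg_bounded (abs_cvg_taylor m cr hD).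
have key (h : C) : `|h| <= D -> `|h| < r - `|w| ->
   `|taylor_coef c m (w + h *: delta_mx 0 j) - taylor_coef c m w - h * L| <=
   (`|h| / D) ^+ 2 * M.
  move=> hD' hr.
  have whr : `|w + h *: delta_mx 0 j| < r.
    by rewrite (le_lt_trans (ler_normD _ _))// (le_lt_trans (lerD (lexx _) (dv h)))// addrC -ltrBrDr.
  have := has_sumD (has_sumD (has_sum_taylor m cr whr)
     (has_sumZ (-1) (has_sum_taylor m cr wr)))
     (has_sumZ (- (h * (m j).+1%:R)) (has_sum_taylor (incr j m) cr wr)).
  rewrite mulN1r mulNr -[_ * _ * taylor_coef _ _ _]mulrA => hs.
  apply: (norm_has_sum_le hs) => A; apply: le_trans (ler_norm_sum _ _ _) _.
  apply: le_trans (ler_wpM2l _ (hM A)); last by rewrite exprn_ge0// divr_ge0// ltW.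
  rewrite mulr_sumr; apply: ler_sum => a _.
  have -> : forall x y z b t : C, b * x + -1 * (b * y) + - t * (b * z) =
      b * (x - y - t * z) by move=> x y z b t; ring.
  rewrite !normrM [leRHS]mulrCA ler_wpM2l//.
  apply: le_trans (bin_monomial_taylor1 _ _ _ _ D0 hD') _.
  rewrite ler_wpM2l ?exprn_ge0 ?divr_ge0 ?(ltW D0)//.
  rewrite real_ler_norm// ger0_real// bin_monomial_ge0// => i.
  by rewrite mxE addr_ge0 ?(ltW D0).
(* Adding 1 keeps the constant positive when [M] is 0, since h is later chosen below e divided by
   it. *)
have K1 : 0 < M / D ^+ 2 + 1 by rewrite ltr_wpDl// divr_ge0// exprn_ge0// ltW.
apply/cvgrPdist_le => e e0; near=> h.
have h0 : h != 0 by near: h; exact: nbhs_dnbhs_neq.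
have -> : L - h^-1 *: ((taylor_coef c m \o shift w) (h *: delta_mx 0 j) -
       taylor_coef c m w) =
   - (h^-1 * (taylor_coef c m (w + h *: delta_mx 0 j) - taylor_coef c m w - h * L)).
  rewrite /= [h *: _ + w]addrC mulrBr mulrA mulVf// mul1r opprB.
  by congr (_ - _).
rewrite normrN normrM normfV ler_pdivrMl ?normr_gt0//.
apply: le_trans (key _ _ _) _.
- near: h; apply: dnbhs0_le => //.
- near: h; apply: dnbhs0_lt; rewrite subr_gt0//.
have -> : (`|h| / D) ^+ 2 * M = `|h| * (`|h| * (M / D ^+ 2)).
  by rewrite exprMn exprVn expr2 -!mulrA [_ * M]mulrC.
rewrite ler_wpM2l//.
apply: (@le_trans _ _ (`|h| * (M / D ^+ 2 + 1))).
  by rewrite ler_wpM2l// lerDl.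
rewrite -ler_pdivlMr//; near: h; apply: dnbhs0_le; rewrite divr_gt0 //.
Unshelve. all: by end_near. Qed.

End PowerSeries.

(** * Mixed derivatives as Taylor coefficients *)

Section MixedDerivatives.
Context {R : realType} {d : nat}.
Local Notation C := (R[i] : numFieldType).
Implicit Types (c : multi_index d -> C) (m n : multi_index d) (w k p : 'rV[C]_d).

(** The factor [b] collects the factorials left by earlier derivatives, which makes the statement
    iterable. Agreement near a point determines the derivative there, so control of [f] on the ball
    suffices. *)
Lemma partial_derivative_taylor c (r : C) (f : 'rV[C]_d -> C) p (b : C) m j :
  abs_cvg_ball c r -> (forall w, `|w| < r -> f (p + w) = b * taylor_coef c m w) ->
  forall w, `|w| < r -> partial_derivative j f (p + w) =
    b * (m j).+1%:R * taylor_coef c (incr j m) w.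
Proof.
move=> cr fE w wr; rewrite /partial_derivative.
have -> : 'D_(delta_mx 0 j) f (p + w) =
    'D_(delta_mx 0 j) (fun x : 'rV[C]_d => f (p + x)) w.
  rewrite /derive; set v := delta_mx 0 j.
  have -> // : (fun h : C => h^-1 *: ((f \o shift (p + w)) (h *: v) - f (p + w))) =
     (fun h => h^-1 *: (((fun x => f (p + x)) \o shift w) (h *: v) - f (p + w))).
  by apply/funext => h /=; rewrite addrCA.
have [h1 h2] := is_derive_taylor_coef m j cr wr.
have -> : 'D_(delta_mx 0 j) (fun x : 'rV[C]_d => f (p + x)) w =
    'D_(delta_mx 0 j) (b \*: taylor_coef c m) w.
  apply: near_eq_derive.
  have near_w : \forall x \near w, `|x - w| < r - `|w|.
    apply/nbhs_ballP; exists (r - `|w|) => /=; first by rewrite subr_gt0.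
    by move=> x; rewrite -ball_normE/= distrC.
  near=> x; apply: fE; rewrite -[x](subrK w).
  rewrite (le_lt_trans (ler_normD _ _))// -ltrBrDr.
  by near: x.
by rewrite deriveZ// h2 /GRing.scale/= mulrA.
Unshelve. all: by end_near. Qed.

Lemma iter_partial_derivative_taylor c (r : C) (f : 'rV[C]_d -> C) p (b : C) m j N :
  abs_cvg_ball c r -> (forall w, `|w| < r -> f (p + w) = b * taylor_coef c m w) ->
  m j = 0%N ->
  forall w, `|w| < r -> iter N (partial_derivative j) f (p + w) =
    b * N`!%:R * taylor_coef c [ffun i => if i == j then N else m i] w.
Proof.
move=> cr fE mj; elim: N => [|N IH] w wr.
  rewrite fact0 [b * 1%:R]mulr1 [LHS](fE w wr); congr (_ * taylor_coef c _ w).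
  by apply/ffunP => i; rewrite ffunE; case: eqP => // ->.
rewrite iterS (partial_derivative_taylor j cr IH wr) ffunE eqxx.
have -> : incr j [ffun i => if i == j then N else m i] =
    [ffun i => if i == j then N.+1 else m i].
  by apply/ffunP => i; rewrite !ffunE; case: eqP => //=; rewrite ?addn1 ?addn0.
by rewrite factS natrM [_.+1%:R * _]mulrC [b * (_ * _)]mulrA.
Qed.

Lemma mixed_derivative_taylor c (r : C) (f : 'rV[C]_d -> C) p n :
  abs_cvg_ball c r ->
  (forall w, `|w| < r -> f (p + w) = taylor_coef c [ffun=> 0%N] w) ->
  forall w, `|w| < r -> mixed_derivative n f (p + w) =
    (\prod_j (n j)`!)%:R * taylor_coef c n w.
Proof.
move=> cr fE w wr; rewrite /mixed_derivative.
suff key (s : seq 'I_d) : uniq s -> forall w, `|w| < r ->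
    foldl (fun g j => iter (n j) (partial_derivative j) g) f s (p + w) =
    (\prod_(j <- s) (n j)`!)%:R *
      taylor_coef c [ffun i => if i \in s then n i else 0%N] w.
  rewrite (key _ (enum_uniq _) w wr) big_enum.
  suff -> : [ffun i => if i \in enum 'I_d then n i else 0%N] = n by [].
  by apply/ffunP => i; rewrite ffunE mem_enum.
(* Peeling off the last variable matches [foldl]. As the list has no repetition, the order in that
   variable is still 0 when its derivatives begin. *)
elim/last_ind: s => [_ v vr|s j IH].
  rewrite big_nil mul1r [LHS](fE v vr).
  by congr taylor_coef; apply/ffunP => i; rewrite !ffunE.
rewrite rcons_uniq => /andP[js us] v vr; rewrite foldl_rcons.
have mj : [ffun i => if i \in s then n i else 0%N] j = 0%N.
  by rewrite ffunE (negbTE js).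
rewrite (iter_partial_derivative_taylor (n j) cr (IH us) mj vr).
rewrite -natrM -cats1 big_cat big_seq1/=; congr (_ * taylor_coef c _ v).
apply/ffunP => i; rewrite !ffunE mem_cat inE orbC.
by case: eqP => // ->.
Qed.

Lemma coef_mixed_derivative c (r : C) (f : 'rV[C]_d -> C) p n : 0 < r ->
  abs_cvg_ball c r ->
  (forall w, `|w| < r -> f (p + w) = taylor_coef c [ffun=> 0%N] w) ->
  mixed_derivative n f p = (\prod_j (n j)`!)%:R * c n.
Proof.
move=> r0 cr fE; rewrite -[p in LHS]addr0 (mixed_derivative_taylor n cr fE) ?normr0//.
by rewrite taylor_coef_at0.
Qed.

(** Both [c] and the zero series expand the function 0 on the ball, so its derivatives at the centre
    give n! c_n = 0. *)
Lemma coef_unique c (r : C) : 0 < r -> abs_cvg_ball c r ->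
  (forall w, `|w| < r -> taylor_coef c [ffun=> 0%N] w = 0) -> c = fun=> 0.
Proof.
move=> r0 cr c0; apply/funext => n.
have z0 : abs_cvg_ball (fun _ : multi_index d => 0 : C) r.
  move=> w wr; have := cr w wr; apply: abs_cvg_le => a.
  by rewrite mul0r normr0 normr_ge0.
have h1 := coef_mixed_derivative (f := fun=> 0) (p := 0) n r0 cr
  (fun w wr => esym (c0 w wr)).
have zs w : taylor_coef (fun _ : multi_index d => 0 : C) [ffun=> 0%N] w = 0.
  by apply: taylor_coefE; apply: eq_has_sum has_sum0 => a; rewrite mul0r.
have h2 := coef_mixed_derivative (f := fun=> 0) (p := 0) n r0 z0
  (fun w _ => esym (zs w)).
apply/eqP; move: h1; rewrite h2 mulr0 => /esym/eqP.
rewrite mulf_eq0 pnatr_eq0 => /orP[|//].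
by rewrite -leqn0 leqNgt prodn_gt0// => i; exact: fact_gt0.
Qed.

End MixedDerivatives.

(** * Re-expansion at another centre *)

Section Reexpansion.
Context {R : realType} {d : nat}.
Local Notation C := (R[i] : numFieldType).
Implicit Types (c : multi_index d -> C) (m n : multi_index d) (w k p : 'rV[C]_d).

(** What remains of the binomial expansion after removing the exponents in [B] is dominated by the
    full expansion at absolute values, uniformly in [B]. *)
Lemma norm_remainder_le (a : multi_index d) (w k : 'rV[C]_d) (B : {fset multi_index d}) :
  `|monomial (w + k) a - \sum_(m <- B) bin_monomial a m w * monomial k m| <=
  monomial (\row_j (`|w 0 j| + `|k 0 j|)) a.
Proof.
have [M [M0 MS]] := binomial_monomial (K := C) a.
rewrite -MS (big_fsetID _ (mem B) M)/=.
have <- : \sum_(m <- [fset x in M | x \in B]%fset) bin_monomial a m w * monomial k m =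
    \sum_(m <- B) bin_monomial a m w * monomial k m.
  apply: big_fset_incl; first by apply/fsubsetP => m; rewrite !inE => /andP[].
  move=> m mB; rewrite !inE mB andbT => mM.
  by rewrite M0 ?mul0r.
rewrite addrC addrK; apply: le_trans (ler_norm_sum _ _ _) _.
have -> : \row_j (`|w 0 j| + `|k 0 j|) = \row_j `|w 0 j| + \row_j `|k 0 j| :> 'rV[C]_d.
  by apply/rowP => j; rewrite !mxE.
rewrite -MS (big_fsetID _ (mem B) M)/= -[leLHS]add0r; apply: lerD.
  apply: sumr_ge0 => m _; apply: mulr_ge0.
    by apply: bin_monomial_ge0 => j; rewrite mxE.
  by apply: prodr_ge0 => j _; rewrite mxE exprn_ge0.
apply: ler_sum => m _; rewrite normrM norm_bin_monomial ler_wpM2l//.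
  by apply: bin_monomial_ge0 => j; rewrite mxE.
rewrite normr_prod le_eqVlt; apply/orP; left; apply/eqP.
by apply: eq_bigr => j _; rewrite normrX mxE.
Qed.

(** No double series is rearranged: for a finite [B] the sum over m passes inside the series over a,
    leaving c_a times the remainder of the a-th monomial. These vanish for a in [A] and are
    dominated, off [A], by a tail of the absolutely convergent series at the points |w_j| +
    |k_j|. *)
Lemma has_sum_reexpansion c (r : C) w k : abs_cvg_ball c r -> `|w| + `|k| < r ->
  has_sum (fun m => taylor_coef c m w * monomial k m)
    (taylor_coef c [ffun=> 0%N] (w + k)).
Proof.
move=> cr wkr e e0.
have wr : `|w| < r by apply: le_lt_trans wkr; rewrite lerDl.
have swr : `|w + k| < r by apply: le_lt_trans wkr; apply: ler_normD.
have xyr : `|\row_j (`|w 0 j| + `|k 0 j|) : 'rV[C]_d| < r.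
  apply: le_lt_trans wkr; apply: row_norm_le => [|j]; first by rewrite addr_ge0.
  by rewrite mxE ger0_norm ?addr_ge0// lerD// row_norm_ge.
have e2 : 0 < e / 2 by rewrite divr_gt0.
have [A hA] := cr _ xyr _ e2.
have [M hM] := choice (fun a => binomial_monomial (K := C) (d := d) a).
(* Such a [B] contains every exponent in the expansions of the monomials of [A], so their remainders
   are 0. *)
exists (\bigcup_(a <- A) M a)%fset => B MB.
suff : `|taylor_coef c [ffun=> 0%N] (w + k) -
    \sum_(m <- B) taylor_coef c m w * monomial k m| <= e / 2.
  move=> h; apply: (le_lt_trans h).
  by rewrite ltr_pdivrMr// ltr_pMr// ltr1n.
have hs0 := has_sum_taylor [ffun=> 0%N] cr swr.
have hsB := has_sum_sum (B : seq _)
  (fun m => has_sumZ (monomial k m) (has_sum_taylor m cr wr)).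
have {hs0 hsB} := has_sumD hs0 (has_sumZ (-1) hsB).
rewrite mulN1r; under [X in _ - X]eq_bigr do rewrite mulrC.
have vE a : c a * bin_monomial a [ffun=> 0%N] (w + k) +
    -1 * \sum_(m <- B) monomial k m * (c a * bin_monomial a m w) =
   c a * (monomial (w + k) a - \sum_(m <- B) bin_monomial a m w * monomial k m).
  rewrite bin_monomial0 mulN1r mulrBr mulr_sumr; congr (_ - _).
  by apply: eq_bigr => m _; rewrite mulrC mulrA.
move=> /(eq_has_sum vE) hs.
apply: (norm_has_sum_le_out hs (D := A)) => [a aA|D AD].
  have [M0 MS] := hM a; rewrite -MS.
  rewrite (@big_fset_incl _ _ _ _ (M a) B) ?subrr ?mulr0//.
    by apply: fsubset_trans MB; apply: bigfcup_sup.
  by move=> m _ mM; rewrite M0// mul0r.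
apply/ltW; apply: le_lt_trans (hA D AD); apply: le_trans (ler_norm_sum _ _ _) _.
apply: ler_sum => a _; rewrite !normrM ler_wpM2l//.
rewrite (le_trans (norm_remainder_le _ _ _ _))// real_ler_norm// ger0_real//.
by apply: prodr_ge0 => j _; rewrite mxE exprn_ge0// addr_ge0.
Qed.

Lemma abs_cvg_ball_taylor c (r : C) w : abs_cvg_ball c r -> `|w| < r ->
  abs_cvg_ball (fun m => taylor_coef c m w) (r - `|w|).
Proof.
move=> cr wr k; rewrite ltrBrDl => kr.
exact: has_sum_abs_cvg (has_sum_reexpansion cr kr).
Qed.

Lemma taylor_coef_add c (r : C) w k : abs_cvg_ball c r -> `|w| + `|k| < r ->
  taylor_coef (fun m => taylor_coef c m w) [ffun=> 0%N] k =
  taylor_coef c [ffun=> 0%N] (w + k).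
Proof.
move=> cr kr; apply: taylor_coefE.
by under eq_fun do rewrite bin_monomial0; apply: has_sum_reexpansion cr kr.
Qed.

(** The expansion at [w] has only zero coefficients. It represents the sum up to distance r - |w| >
    2r / 3 from [w], and the ball of radius r / 3 about 0 lies within that distance. *)
Lemma vanish_near_center c (r : C) w (e : C) : abs_cvg_ball c r -> 0 < e ->
  `|w| < r / 3 ->
  (forall k, `|k| < e -> taylor_coef c [ffun=> 0%N] (w + k) = 0) ->
  forall k, `|k| < r / 3 -> taylor_coef c [ffun=> 0%N] k = 0.
Proof.
move=> cr e0 w3 ce k k3.
have r3 : r = r / 3 + r / 3 + r / 3 by field.
have r30 : 0 < r / 3 by apply: le_lt_trans w3.
have wr : `|w| < r.
  by rewrite (lt_trans w3)// [ltRHS]r3 -addrA ltrDl addr_gt0.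
have s0 : 0 < r - `|w| by rewrite subr_gt0.
have g0 : (fun m => taylor_coef c m w) = fun=> 0.
  have [e1 [e10 e1e e1s]] := exists_pos_le2 e0 s0.
  apply: (@coef_unique _ _ _ e1) => // v ve.
    apply: (abs_cvg_ball_taylor cr wr); exact: lt_le_trans ve e1s.
  rewrite (taylor_coef_add cr); last by rewrite addrC -ltrBrDr (lt_le_trans ve).
  by apply: ce; apply: lt_le_trans ve e1e.
have kw : `|w| + `|k - w| < r.
  rewrite [ltRHS]r3 -addrA; apply: ltrD => //.
  by rewrite (le_lt_trans (ler_normB _ _))// ltrD.
have := taylor_coef_add cr kw; rewrite g0 [w + _]addrC subrK => <-.
by apply: taylor_coefE; apply: eq_has_sum has_sum0 => a; rewrite mul0r.
Qed.

End Reexpansion.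

(** * Identity theorem along segments *)

Section Identity.
Context {R : realType} {d : nat}.
Local Notation C := (R[i] : numFieldType).
Implicit Types (c : multi_index d -> C) (w k p q : 'rV[C]_d) (phi : 'rV[C]_d -> C).

Lemma power_series_at_taylor phi p g : power_series_at phi p g ->
  exists r : C, [/\ 0 < r, abs_cvg_ball g r &
    forall w, `|w| < r -> phi (p + w) = taylor_coef g [ffun=> 0%N] w].
Proof.
move=> /nbhs_ballP[r /= r0 hr]; exists r.
have hs w : `|w| < r -> has_sum (fun a => g a * monomial w a) (phi (p + w)).
  move=> wr; have := hr (p + w); rewrite -ball_normE/= opprD addrA subrr sub0r normrN.
  have -> : p + w - p = w by rewrite addrC addKr.
  by move=> /(_ wr) /has_sumP.
split=> // w wr; first exact: has_sum_abs_cvg (hs w wr).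
apply/esym/taylor_coefE; apply: eq_has_sum (hs w wr) => a.
by rewrite bin_monomial0.
Qed.

Definition agree_near phi c q :=
  exists2 e : C, 0 < e &
    forall k, `|k| < e -> phi (q + k) = taylor_coef c [ffun=> 0%N] (q + k).

(** The difference [g'] of the expansion of [phi] at [p] and the re-expansion of [c] at [p]
    converges on a ball about [p]. If it vanishes near one point of the ball of a third of that
    radius, [vanish_near_center] makes it vanish on all of that smaller ball. *)
Lemma agree_near_locally_constant phi c p : analytic_on_polydisk phi ->
  abs_cvg_ball c 1 -> `|p| < 1 ->
  exists2 e : C, 0 < e & forall q x, `|q - p| < e -> `|x - p| < e ->
    agree_near phi c q -> agree_near phi c x.
Proof.
move=> phia c1 p1.
have [g] : exists g, power_series_at phi p g.
  by apply: phia => j; apply: le_lt_trans p1; apply: row_norm_ge.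
move=> /power_series_at_taylor[r0 [r00 gr phiE]].
have s0 : 0 < 1 - `|p| by rewrite subr_gt0.
have [r [r_gt0 rr0 rs]] := exists_pos_le2 r00 s0.
pose g' a := g a + -1 * taylor_coef c a p.
have gr' : abs_cvg_ball g' r.
  move=> w wr.
  have h1 := gr w (lt_le_trans wr rr0).
  have h2 := abs_cvg_ball_taylor c1 p1 (lt_le_trans wr rs).
  have := abs_cvgD h1 (abs_cvgZ (-1) h2).
  by under eq_fun do rewrite mulrA -mulrDl.
have gE w : `|w| < r -> taylor_coef g' [ffun=> 0%N] w =
    phi (p + w) - taylor_coef c [ffun=> 0%N] (p + w).
  move=> wr; apply: taylor_coefE.
  rewrite (phiE _ (lt_le_trans wr rr0)).
  have pw : `|p| + `|w| < 1 by rewrite addrC -ltrBrDr (lt_le_trans wr).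
  have h1 := has_sum_taylor [ffun=> 0%N] gr (lt_le_trans wr rr0).
  have h2 := has_sumZ (-1) (has_sum_reexpansion c1 pw).
  have := has_sumD h1 h2; rewrite mulN1r; apply: eq_has_sum => a.
  by rewrite !bin_monomial0 mulrA -mulrDl.
exists (r / 3); first by rewrite divr_gt0.
have r3r : r / 3 < r by rewrite ltr_pdivrMr// ltr_pMr// ltr1n.
move=> q x qp xp [e e0 he].
have van : forall k, `|k| < r / 3 -> taylor_coef g' [ffun=> 0%N] k = 0.
  have s1 : 0 < r - `|q - p| by rewrite subr_gt0 (lt_trans qp).
  have [e1 [e10 e1e e1s]] := exists_pos_le2 e0 s1.
  apply: (vanish_near_center gr' e10 qp) => k ke.
  rewrite gE; last first.
    rewrite (le_lt_trans (ler_normD _ _))// addrC -ltrBrDr.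
    exact: lt_le_trans ke e1s.
  rewrite addrA [p + _]addrC subrK he ?subrr//.
  exact: lt_le_trans ke e1e.
exists (r / 3 - `|x - p|); first by rewrite subr_gt0.
move=> k; rewrite ltrBrDl => xk.
have kr : `|x - p + k| < r / 3 by apply: le_lt_trans xk; apply: ler_normD.
have := van _ kr; rewrite gE ?(lt_trans kr)//.
by rewrite addrA [p + _]addrC subrK => /eqP; rewrite subr_eq0 => /eqP.
Qed.

(** Connectedness of [0, 1]: the set of t for which [phi] and the series agree near t z contains 0
    and is open and closed, because agreement is locally constant. *)
Lemma identity_theorem phi c : analytic_on_polydisk phi ->
  power_series_at phi 0 c -> abs_cvg_ball c 1 ->
  forall z, `|z| < 1 -> phi z = taylor_coef c [ffun=> 0%N] z.
Proof.
move=> phia phi0 c1 z z1.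
pose g (t : R) : 'rV[C]_d := (t%:C)%C *: z.
have gd s t : `|g s - g t| <= `|s - t|%:C%C.
  by rewrite -scalerBl normrZ -rmorphB/= norm_real_complex ler_piMr ?(ltW z1)// ler0c.
have g1 t : t \in `[0, 1] -> `|g t| < 1.
  rewrite in_itv/= => /andP[t0 t1].
  rewrite normrZ norm_real_complex ger0_norm//; apply: le_lt_trans z1; rewrite ler_piMl//.
  by rewrite lec1.
pose P t := agree_near phi c (g t).
have P0 : P 0.
  have [r [r0 cr phiE]] := power_series_at_taylor phi0.
  have g0 k : g 0 + k = k by rewrite /g scale0r add0r.
  exists r; first exact: r0.
  by move=> k kr; rewrite g0; have := phiE k kr; rewrite add0r.
have loc t : t \in `[0, 1] -> exists2 e : R, 0 < e &
    forall s u, `|s - t| < e -> `|u - t| < e -> P s -> P u.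
  move=> t01; have [e e0 he] := agree_near_locally_constant phia c1 (g1 _ t01).
  have eE := ge0_ReE (ltW e0).
  exists (complex.Re e); first by rewrite -ltcR -eE.
  move=> s u st ut; apply: he; rewrite (le_lt_trans (gd _ _))// eE ltcR//.
suff [e e0 he] : P 1.
  by have := he 0; rewrite normr0 addr0 /g scale1r; apply.
pose I01 : set R := [set` `[0, 1]].
(* Made total in t for [choice]; off the segment the radius is a dummy 0. *)
have loc' : forall t : R, exists e : R, I01 t -> 0 < e /\ 
    forall s u, `|s - t| < e -> `|u - t| < e -> P s -> P u.
  move=> t; have [/loc[e e0 he]|nt] := boolP (t \in `[0, 1]).
    by exists e => _; split.
  by exists 0 => /=; rewrite /I01/= (negbTE nt).
have [f hf] := choice loc'.
have I0 : I01 0 by rewrite /I01/= in_itv/= lexx ler01.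
have I1 : I01 1 by rewrite /I01/= in_itv/= lexx ler01.
suff IP : I01 `&` P = I01 by have [] : (I01 `&` P) 1 by rewrite IP.
(* On the segment this open set cuts out [P] when [A] is [P], and the complement of [P] when [A] is
   that complement. *)
pose U (A : set R) := \bigcup_(t in I01 `&` A) ball t (f t).
have oU A : open (U A).
  by apply: bigcup_open => t [It _]; apply: ball_open.
have UP A t : I01 t -> A t -> U A t.
  by move=> It At; exists t => //; apply: ballxx; have [] := hf t It.
have PU t : I01 t -> U P t -> P t.
  move=> It [s [Is Ps]]; rewrite -ball_normE/= distrC => ts; have [f0 hs] := hf s Is.
  by apply: (hs s t _ ts Ps); rewrite subrr normr0.
have nPU t : I01 t -> U (~` P) t -> ~ P t.
  move=> It [s [Is nPs]]; rewrite -ball_normE/= distrC => ts Pt.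
  have [f0 hs] := hf s Is.
  by apply/nPs/(hs t s ts _ Pt); rewrite subrr normr0.
apply: segment_connected; first by exists 0.
- exists (U P); first exact: oU.
  apply/seteqP; split=> t [It Ht]; (split; first exact: It).
    exact: UP.
  exact: PU.
- exists (~` U (~` P)); first by apply: open_closedC; apply: oU.
  apply/seteqP; split=> t [It Ht]; (split; first exact: It).
    by move=> /(nPU _ It).
  by have [//|nP] := pselect (P t); case: Ht; apply: UP.
Qed.

End Identity.

(** * Finite-dimensional Hilbert spaces *)

Section DotL2.
Context (R : realType) (I : finType).
Local Notation C := (R[i] : numClosedFieldType).
Local Notation V := {ffun I -> C^o}.

Definition l2_dot (x y : V) : C := \sum_i x i * (y i)^*.

Lemma l2_dot_linearl y : linear_for *%R (l2_dot ^~ y).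
Proof.
move=> a u v; rewrite /l2_dot mulr_sumr -big_split/=; apply: eq_bigr => i _.
by rewrite !ffunE mulrDl -mulrA.
Qed.

Lemma l2_dot_linearr x : linear_for (Num.conj \; *%R) (l2_dot x).
Proof.
move=> a u v; rewrite /l2_dot /= mulr_sumr -big_split/=; apply: eq_bigr => i _.
by rewrite !ffunE rmorphD rmorphM mulrDr mulrCA.
Qed.

Lemma l2_dot_herm x y : l2_dot x y = (-1) ^+ false * (l2_dot y x)^*.
Proof.
rewrite mul1r /l2_dot rmorph_sum; apply: eq_bigr => i _.
by rewrite rmorphM /= conjCK mulrC.
Qed.

Lemma l2_dot_gt0 x : x != 0 -> 0 < l2_dot x x.
Proof.
move=> x0; have [i xi] : exists i, x i != 0.
  apply/existsP; rewrite -negb_forall; apply: contra x0 => /forallP x0.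
  by apply/eqP/ffunP => i; rewrite ffunE; apply/eqP.
rewrite /l2_dot (bigD1 i)//= ltr_pwDl//.
  by rewrite -normCK exprn_gt0// normr_gt0.
by apply: sumr_ge0 => j _; rewrite -normCK exprn_ge0.
Qed.

HB.instance Definition _ := bilinear_isBilinear.Build C V V C *%R (Num.conj \; *%R)
  l2_dot (l2_dot_linearl, l2_dot_linearr).
HB.instance Definition _ := isHermitianSesquilinear.Build C V false Num.conj
  l2_dot l2_dot_herm.
HB.instance Definition _ := isDotProduct.Build C V l2_dot l2_dot_gt0.

Definition l2_norm (x : V) : C := sqrtC (l2_dot x x).

Lemma l2_norm_sqr x : l2_norm x ^+ 2 = \sum_i `|x i| ^+ 2.
Proof. by rewrite sqrtCK; apply: eq_bigr => i _; rewrite normCK. Qed.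

Lemma l2_norm_triangle x y : l2_norm (x + y) <= l2_norm x + l2_norm y.
Proof. exact: (triangle_lerif l2_dot x y). Qed.

Lemma l2_normZ (a : C) x : l2_norm (a *: x) = `|a| * l2_norm x.
Proof.
rewrite /l2_norm dnormZ sqrtCM ?nnegrE ?dnorm_ge0 ?exprn_ge0//.
by rewrite sqrCK.
Qed.

Lemma l2_norm_eq0 x : l2_norm x = 0 -> x = 0.
Proof. by move=> /eqP; rewrite sqrt_dnorm_eq0 => /eqP. Qed.

End DotL2.

Definition l2 (R : realType) (I : finType) := {ffun I -> R[i]^o}.
HB.instance Definition _ (R : realType) (I : finType) :=
  GRing.Lmodule.copy (l2 R I) {ffun I -> R[i]^o}.
HB.instance Definition _ (R : realType) (I : finType) :=
  Lmodule_isNormed.Build R[i] (l2 R I) (@l2_norm_triangle R I)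
    (@l2_normZ R I) (@l2_norm_eq0 R I).

Section L2Complete.
Context (R : realType) (I : finType).
Local Notation C := (R[i] : numFieldType).
Implicit Types x y : l2 R I.

Lemma norm_sqrE x : `|x| ^+ 2 = \sum_i `|x i| ^+ 2.
Proof. exact: l2_norm_sqr. Qed.

Lemma coord_norm_le x i : `|x i| <= `|x|.
Proof.
rewrite -(@ler_pXn2r _ 2) ?nnegrE//; rewrite norm_sqrE (bigD1 i)//= lerDl.
by apply: sumr_ge0 => j _; rewrite exprn_ge0.
Qed.

Lemma norm_le_sum x : `|x| <= \sum_i `|x i|.
Proof.
rewrite -(@ler_pXn2r _ 2) ?nnegrE ?sumr_ge0// norm_sqrE expr2 mulr_suml.
apply: ler_sum => i _; rewrite expr2 ler_wpM2l// (bigD1 i)//= lerDl.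
by apply: sumr_ge0.
Qed.

Lemma l2_complete (F : set_system (l2 R I)) :
  ProperFilter F -> cauchy F -> cvg F.
Proof.
move=> FF /cauchyP Fc; apply/cvg_ex.
have ev (i : I) : exists l : C, ((fun x : l2 R I => x i : C) @ F) --> l.
  apply: complex_complete; apply/cauchyP => e e0.
  have [x Fx] := Fc _ e0; exists (x i).
  change (F ((fun x : l2 R I => x i : C) @^-1` ball (x i : C) e)).
  apply: filterS Fx => y; rewrite -ball_normE/= => h.
  rewrite -ball_normE/=; apply: le_lt_trans h.
  by have := coord_norm_le (x - y) i; rewrite !ffunE.
have [l hl] := choice ev.
exists ([ffun i => l i] : l2 R I); apply/cvgrPdist_lt => e e0.
(* The successor keeps the divisor positive for an empty [I] and makes the sum of the coordinate
   bounds strictly smaller than e. *)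
pose e' := e / (#|I|.+1)%:R.
have e'0 : 0 < e' by rewrite divr_gt0.
have H : F [set x : l2 R I | forall i, `|l i - x i| < e'].
  apply: filter_forall => i.
  by move/cvgrPdist_lt/(_ _ e'0): (hl i).
apply: filterS H => x hx; apply: le_lt_trans (norm_le_sum _) _.
apply: (@le_lt_trans _ _ (\sum_(i : I) e')).
  by apply: ler_sum => i _; rewrite !ffunE ltW// hx.
rewrite sumr_const -mulr_natl /e' mulrCA gtr_pMr// ltr_pdivrMr// mul1r.
by rewrite ltr_nat.
Qed.

HB.instance Definition _ := Uniform_isComplete.Build (l2 R I) l2_complete.

Lemma l2_norm_dot x : `|x| ^+ 2 = l2_dot x x.
Proof. exact: sqrtCK. Qed.

End L2Complete.

(** * Disc automorphisms of the nilpotent shift *)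

Section ShiftMobius.
Context {C : numClosedFieldType} {N : nat}.
Implicit Types (M : 'M[C]_N.+1) (z : C).

(** For a polynomial in the shift S, [lower_band p] amounts to divisibility by S^p, and
    [upper_band p] to degree at most p modulo the vanishing powers of S; hence both are additive
    under products. *)
Definition lower_band p M := forall i k : 'I_N.+1, (i < k + p)%N -> M i k = 0.
Definition upper_band p M := forall i k : 'I_N.+1, (k + p < i)%N -> M i k = 0.

Lemma lower_band_mul p q M M' :
  lower_band p M -> lower_band q M' -> lower_band (p + q) (M *m M').
Proof.
move=> hM hM' i k ik; rewrite mxE big1// => l _.
have [h|h] := ltnP i (l + p); first by rewrite hM// mul0r.
by rewrite hM' ?mulr0// -(ltn_add2r p) (leq_ltn_trans h)// addnAC -addnA.
Qed.

Lemma upper_band_mul p q M M' :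
  upper_band p M -> upper_band q M' -> upper_band (p + q) (M *m M').
Proof.
move=> hM hM' i k ik; rewrite mxE big1// => l _.
have [h|h] := ltnP (l + p) i; first by rewrite hM// mul0r.
rewrite hM' ?mulr0// -(ltn_add2r p); apply: leq_trans h.
by rewrite addnAC -addnA.
Qed.

Lemma lower_band_exp p M n : lower_band p M -> lower_band (n * p) (M ^+ n).
Proof.
move=> hM; elim: n => [|n IH].
  by move=> i k; rewrite addn0 => ik; rewrite mxE -val_eqE/= ltn_eqF.
by rewrite exprS mulSn; apply: lower_band_mul.
Qed.

Lemma upper_band_exp p M n : upper_band p M -> upper_band (n * p) (M ^+ n).
Proof.
move=> hM; elim: n => [|n IH].
  by move=> i k; rewrite addn0 => ik; rewrite mxE -val_eqE/= gtn_eqF.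
by rewrite exprS mulSn; apply: upper_band_mul.
Qed.

Arguments lower_band_exp {p M} n _.
Arguments upper_band_exp {p M} n _.

Definition shift_mx : 'M[C]_N.+1 := \matrix_(i, k) (i == k.+1 :> nat)%:R.

Lemma shift_mx_mul n (M : 'M[C]_(N.+1, n)) i k :
  (shift_mx *m M) i k = if i == 0%N :> nat then 0 else M (inord i.-1) k.
Proof.
rewrite mxE; case: i => -[|i] iN /=.
  by rewrite big1// => l _; rewrite mxE mul0r.
rewrite (bigD1 (inord i))//= mxE inordK ?(ltnW iN)// eqxx mul1r big1 ?addr0//.
move=> l li; rewrite mxE eqSS (_ : (i == l :> nat) = false) ?mul0r//.
apply: contraNF li => /eqP il; apply/eqP/val_inj.
by rewrite /= inordK ?(ltnW iN).
Qed.

Lemma shift_exp_mul n M i k :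
  (shift_mx ^+ n *m M) i k = if (n <= i)%N then M (inord (i - n)) k else 0.
Proof.
elim: n i => [|n IH] i.
  by rewrite expr0 mul1mx subn0 inord_val.
rewrite exprS -mulmxA shift_mx_mul; case: eqP => [->//|/eqP i0].
rewrite IH; case: i i0 => -[//|i] iN _ /=; rewrite inordK ?(ltnW iN)//.
Qed.

Lemma lower_band_shift : lower_band 1 shift_mx.
Proof. by move=> i k; rewrite addn1 => ik; rewrite mxE ltn_eqF. Qed.

Lemma upper_band_shift : upper_band 1 shift_mx.
Proof. by move=> i k; rewrite addn1 => ik; rewrite mxE gtn_eqF. Qed.

(* The disc automorphism w |-> (z + w) / (1 + conj(z) w) at w := shift_mx. *)
Definition mobius_den z : 'M[C]_N.+1 := 1 + z^* *: shift_mx.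
Definition mobius_shift z : 'M[C]_N.+1 := (z%:M + shift_mx) * (mobius_den z)^-1.

Lemma lower_band_den z : lower_band 0 (mobius_den z).
Proof.
move=> i k; rewrite addn0 => ik.
have e1 : (i == k) = false by rewrite -val_eqE/= ltn_eqF.
have e2 : (i == k.+1 :> nat) = false by rewrite ltn_eqF// ltnW.
by rewrite !mxE e1 e2 mulr0 addr0.
Qed.

Lemma upper_band_den z : upper_band 1 (mobius_den z).
Proof.
move=> i k; rewrite addn1 => ik.
have e1 : (i == k) = false by rewrite -val_eqE/= gtn_eqF// ltnW.
have e2 : (i == k.+1 :> nat) = false by rewrite gtn_eqF.
by rewrite !mxE e1 e2 mulr0 addr0.
Qed.

Arguments lower_band_den z : clear implicits.
Arguments upper_band_den z : clear implicits.

Lemma den_unit z : mobius_den z \is a GRing.unit.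
Proof.
rewrite unitmxE det_trig.
  rewrite big1 ?unitr1// => i _; rewrite !mxE eqxx ltn_eqF// mulr0 addr0//.
apply/is_trig_mxP => i k ik; apply: lower_band_den.
by rewrite addn0.
Qed.

Lemma den_inv_rec z :
  (mobius_den z)^-1 = 1 - z^* *: (shift_mx *m (mobius_den z)^-1).
Proof.
have := mulrV (den_unit z); rewrite {1}/mobius_den mulrDl mul1r -scalerAl.
by move=> <-; rewrite addrK.
Qed.

(** The inverse is never written out: this recursion on rows yields its triangularity and its corner
    entry. *)
Lemma den_inv_entry z i k : (mobius_den z)^-1 i k =
  (i == k)%:R - (if i == 0%N :> nat then 0 else z^* * (mobius_den z)^-1 (inord i.-1) k).
Proof.
have := shift_mx_mul (mobius_den z)^-1 i k; rewrite mxE => h.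
by rewrite {1}den_inv_rec ![in LHS]mxE h; case: ifP => //; rewrite mulr0.
Qed.

Lemma lower_band_den_inv z : lower_band 0 (mobius_den z)^-1.
Proof.
move=> [i iN] k; rewrite /= addn0; elim: i iN => [|i IH] iN ik.
  rewrite den_inv_entry/= -val_eqE/= subr0.
  by rewrite ltn_eqF.
rewrite den_inv_entry/= -val_eqE/= ltn_eqF// (_ : inord i = Ordinal (ltnW iN)).
  by rewrite IH ?(ltnW ik)// mulr0 subr0.
by apply/val_inj; rewrite /= inordK// ltnW.
Qed.

Arguments lower_band_den_inv z : clear implicits.

Lemma den_inv00 z : (mobius_den z)^-1 0 0 = 1.
Proof. by rewrite den_inv_entry/= subr0. Qed.

Lemma comm_shift_den z : GRing.comm shift_mx (mobius_den z).
Proof.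
by rewrite /GRing.comm /mobius_den mulrDr mulrDl mulr1 mul1r -scalerAr -scalerAl.
Qed.

(** Splitting off the scalar z, by z + w = z (1 + conj(z) w) + (1 - |z|^2) w, leaves a multiple of
    S, so that powers expand binomially by order in S. *)
Lemma mobius_shiftE z : mobius_shift z =
  z%:M + (1 - `|z| ^+ 2) *: (shift_mx * (mobius_den z)^-1).
Proof.
rewrite /mobius_shift.
have -> : z%:M + shift_mx = z%:M * mobius_den z + (1 - `|z| ^+ 2) *: shift_mx.
  rewrite /mobius_den mulrDr mulr1 -addrA; congr (_ + _).
  rewrite -scalerAr -[z%:M]scalemx1 -scalerAl mul1r scalerA -scalerDl normCK [z^* * z]mulrC addrC subrK.
  by rewrite scale1r.
by rewrite mulrDl mulrK ?den_unit// -scalerAl.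
Qed.

Lemma mobius_shift_exp z m : mobius_shift z ^+ m =
  \sum_(i < m.+1) ('C(m, i)%:R * z ^+ (m - i) * (1 - `|z| ^+ 2) ^+ i) *:
     (shift_mx ^+ i * (mobius_den z)^-1 ^+ i).
Proof.
have cz (a : C) (M : 'M[C]_N.+1) : GRing.comm a%:M M.
  by change (a%:M *m M = M *m a%:M); rewrite mul_mx_scalar mul_scalar_mx.
rewrite mobius_shiftE exprDn_comm; last exact: cz.
apply: eq_bigr => i _; rewrite exprZn exprMn_comm; last first.
  by apply: commrV; apply: comm_shift_den.
rewrite -rmorphXn /= -[_%:M * _]/(_ *m _) mul_scalar_mx scalerA -scaler_nat scalerA.
by rewrite mulrA.
Qed.

Lemma lower_band_mobius_term z i :
  lower_band i (shift_mx ^+ i * (mobius_den z)^-1 ^+ i).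
Proof.
have := lower_band_mul (lower_band_exp i lower_band_shift)
  (lower_band_exp i (lower_band_den_inv z)).
by rewrite muln1 muln0 addn0.
Qed.

Arguments lower_band_mobius_term z i : clear implicits.

Lemma mobius_shift_exp_upper z m (i k : 'I_N.+1) : (i < k)%N ->
  (mobius_shift z ^+ m) i k = 0.
Proof.
move=> ik; rewrite mobius_shift_exp summxE big1// => p _.
by rewrite mxE lower_band_mobius_term ?mulr0// ltn_addr.
Qed.

Lemma mobius_shift_exp_diag z m (i : 'I_N.+1) : (mobius_shift z ^+ m) i i = z ^+ m.
Proof.
rewrite mobius_shift_exp summxE big_ord_recl big1 => [|p _].
  by rewrite mxE bin0 subn0 expr0 mulr1 mul1r !expr0 mulr1 mxE eqxx mulr1 addr0.
by rewrite mxE lower_band_mobius_term ?mulr0// /bump/= -[X in (X < _)%N]addn0 ltn_add2l.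
Qed.

Lemma scale_mobius_shift_exp_upper (q z : C) m (i k : 'I_N.+1) : (i < k)%N ->
  ((q *: mobius_shift z) ^+ m) i k = 0.
Proof. by move=> ik; rewrite exprZn mxE mobius_shift_exp_upper// mulr0. Qed.

Lemma scale_mobius_shift_exp_diag (q z : C) m (i : 'I_N.+1) :
  ((q *: mobius_shift z) ^+ m) i i = (q * z) ^+ m.
Proof. by rewrite exprZn mxE mobius_shift_exp_diag exprMn. Qed.

(** In the expansion of the power, the term of order p contains S^p den^-p. After multiplication by
    den^(n - 1), p < n leaves a polynomial of degree at most n - 1 and p > n leaves a multiple of
    S^p; neither has an entry at (n, 0). The term p = n gives S^n den^-1, whose entry there is 1. *)
Lemma mobius_shift_exp_den z m (n : 'I_N.+1) :
  (mobius_shift z ^+ m *m mobius_den z ^+ n.-1) n 0 =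
  'C(m, n)%:R * z ^+ (m - n) * (1 - `|z| ^+ 2) ^+ n.
Proof.
rewrite mobius_shift_exp mulmx_suml summxE.
have term (p : nat) : p != n ->
    (shift_mx ^+ p * (mobius_den z)^-1 ^+ p *m mobius_den z ^+ n.-1) n 0 = 0.
  rewrite neq_ltn => /orP[pn|np].
    have n0 : (0 < n)%N := leq_ltn_trans (leq0n p) pn.
    have pn1 : (p <= n.-1)%N by rewrite -ltnS prednK.
    rewrite -(subnKC pn1) exprD -mulmxA -[_ *m (_ * _)]/(_ * (_ * _)) [_^-1 ^+ p * (_ * _)]mulrA.
    rewrite -exprMn_comm; last by apply: commr_sym; apply: commrV.
    rewrite mulVr ?den_unit// expr1n mul1r.
    have := upper_band_mul (upper_band_exp p upper_band_shift)
      (upper_band_exp (n.-1 - p) (upper_band_den z)).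
    by rewrite !muln1 subnKC//; apply; rewrite add0n prednK.
  have := lower_band_mul (lower_band_mobius_term z p)
    (lower_band_exp n.-1 (lower_band_den z)).
  by rewrite muln0 addn0; apply; rewrite add0n.
have [mn|nm] := ltnP m n.
  rewrite bin_small// !mul0r big1// => p _.
  rewrite -scalemxAl mxE term ?mulr0//.
  by rewrite neq_ltn (leq_ltn_trans _ mn)// -ltnS.
have nm1 : (n < m.+1)%N by [].
rewrite (bigD1 (Ordinal nm1))//= big1 ?addr0; last first.
  by move=> p pn; rewrite -scalemxAl mxE term ?mulr0.
rewrite -scalemxAl mxE -[RHS]mulr1; congr (_ * _).
rewrite -mulmxA shift_exp_mul leqnn subnn (_ : inord 0 = 0); last first.
  by apply/val_inj; rewrite /= inordK.
(* For n = 0 the truncated exponent [n.-1] is 0 and both powers are the identity; otherwise exactly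
   one inverse factor survives. *)
case: (n : nat) => [|n']; first by rewrite !expr0 mul1mx mxE.
rewrite exprS /= -mulmxA -[_ *m _ ^+ n']/(_ * _) -exprMn_comm; last first.
  by apply: commr_sym; apply: commrV.
by rewrite mulVr ?den_unit// expr1n mulmx1 den_inv00.
Qed.

(** Writing v = den y and s = S y, the two vectors are y + conj(z) s and z y + s. Coordinatewise,
    the difference of their squared moduli is (1 - |z|^2)(|y_i|^2 - |s_i|^2), and S only moves
    coordinates and drops the last one. *)
Lemma mobius_shift_contraction z (v : 'cV[C]_N.+1) : `|z| <= 1 ->
  \sum_i `|(mobius_shift z *m v) i 0| ^+ 2 <= \sum_i `|v i 0| ^+ 2.
Proof.
move=> z1; pose y := (mobius_den z)^-1 *m v; pose s := shift_mx *m y.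
have -> : v = mobius_den z *m y.
  by rewrite /y mulmxA [_ *m _^-1](mulrV (den_unit z)) mul1mx.
have -> : mobius_shift z *m (mobius_den z *m y) = z *: y + s.
  rewrite mulmxA /mobius_shift -[_ *m mobius_den z]/(_ * _) mulrVK ?den_unit//.
  by rewrite mulmxDl mul_scalar_mx.
have -> : mobius_den z *m y = y + z^* *: s.
  by rewrite /mobius_den mulmxDl mul1mx -scalemxAl.
rewrite -subr_ge0 -sumrB.
have -> : \sum_i (`|(y + z^* *: s) i 0| ^+ 2 - `|(z *: y + s) i 0| ^+ 2) =
    (1 - `|z| ^+ 2) * (\sum_i `|y i 0| ^+ 2 - \sum_i `|s i 0| ^+ 2).
  rewrite -sumrB mulr_sumr; apply: eq_bigr => i _; rewrite !mxE !normCK.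
  by rewrite !rmorphD !rmorphM /= conjCK; ring.
rewrite mulr_ge0 ?subr_ge0 ?expr_le1//.
rewrite big_ord_recl [leRHS]big_ord_recr/= /s shift_mx_mul/= normr0 expr0n/= add0r.
rewrite -[leLHS]addr0 lerD ?exprn_ge0// ler_sum// => i _.
rewrite shift_mx_mul/= (_ : inord i = widen_ord (leqnSn N) i)//.
by apply/val_inj; rewrite /= inordK// ltnS ltnW.
Qed.

Lemma upper_band_den_exp z m (k : 'I_N.+1) : (m < k)%N ->
  (mobius_den z ^+ m) k 0 = 0.
Proof.
move=> mk; apply: (upper_band_exp m (upper_band_den z)).
by rewrite muln1 add0n.
Qed.

(** S does not increase the l1 norm of a column, so each factor den multiplies that norm by at most
    1 + |z|. *)
Lemma sum_den_exp_le z m :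
  \sum_k `|(mobius_den z ^+ m) k 0| <= (1 + `|z|) ^+ m.
Proof.
elim: m => [|m IH].
  rewrite !expr0 (bigD1 0)//= big1 ?addr0 ?mxE ?eqxx ?normr1// => k k0.
  by rewrite mxE (negbTE k0) normr0.
rewrite [in leRHS]exprS; apply: le_trans (ler_wpM2l _ IH); last by rewrite addr_ge0.
set M := mobius_den z ^+ m.
apply: (@le_trans _ _ (\sum_k (`|M k 0| + `|z| * `|(shift_mx *m M) k 0|))).
  apply: ler_sum => k _; rewrite exprS -/M /mobius_den mulrDl mul1r -scalerAl.
  have -> : (M + z^* *: (shift_mx * M)) k 0 = M k 0 + z^* * (shift_mx *m M) k 0.
    by rewrite [LHS]mxE; congr (_ + _); rewrite [LHS]mxE.
  by rewrite (le_trans (ler_normD _ _))// lerD// normrM norm_conjC.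
rewrite big_split/= -mulr_sumr mulrDl mul1r lerD// ler_wpM2l//.
rewrite big_ord_recl [leRHS]big_ord_recr/= shift_mx_mul/= normr0 add0r.
rewrite -[leLHS]addr0 lerD// ler_sum// => i _.
rewrite shift_mx_mul/= (_ : inord i = widen_ord (leqnSn N) i)//.
by apply/val_inj; rewrite /= inordK// ltnS ltnW.
Qed.

End ShiftMobius.

(** * Tensor powers *)

Section TensorAction.
Context {R : realType} {d N : nat}.
Local Notation C := (R[i] : numClosedFieldType).
Local Notation Idx := {ffun 'I_d -> 'I_N.+1}.
Local Notation H := (l2 R Idx).
Implicit Types (A : 'M[C]_N.+1) (x : H) (j : 'I_d).

Definition upd (al : Idx) j (k : 'I_N.+1) : Idx :=
  [ffun i => if i == j then k else al i].

Lemma updE al j k : upd al j k j = k. Proof. by rewrite ffunE eqxx. Qed.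

Lemma upd_upd al j k l : upd (upd al j k) j l = upd al j l.
Proof. by apply/ffunP => i; rewrite !ffunE; case: eqP. Qed.

Lemma upd_id al j : upd al j (al j) = al.
Proof. by apply/ffunP => i; rewrite !ffunE; case: eqP => // ->. Qed.

Lemma updC al j j' k l : j != j' -> upd (upd al j k) j' l = upd (upd al j' l) j k.
Proof.
move=> jj'; apply/ffunP => i; rewrite !ffunE.
by case: (i =P j') => // ->; case: eqP => // h; rewrite h eqxx in jj'.
Qed.

(* A acting on the j-th factor of the d-fold tensor power of C^(N+1). *)
Definition act A j x : H := [ffun al : Idx => \sum_k A (al j) k * x (upd al j k)].

Lemma act_is_linear A j : linear (act A j).
Proof.
move=> a x y; apply/ffunP => al; rewrite !ffunE.
rewrite /GRing.scale/= mulr_sumr -big_split/=; apply: eq_bigr => k _.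
by rewrite !ffunE mulrDr mulrCA.
Qed.

HB.instance Definition _ A j :=
  GRing.isLinear.Build C H H *:%R (act A j) (act_is_linear A j).

Lemma act_mul A A' j x : act A j (act A' j x) = act (A *m A') j x.
Proof.
apply/ffunP => al; rewrite !ffunE.
transitivity (\sum_k \sum_l A (al j) k * A' k l * x (upd al j l)).
  apply: eq_bigr => k _; rewrite ffunE mulr_sumr; apply: eq_bigr => l _.
  by rewrite updE upd_upd mulrA.
by rewrite exchange_big/=; apply: eq_bigr => l _; rewrite mxE mulr_suml.
Qed.

Lemma act_comm A A' j j' x : A *m A' = A' *m A \/ j != j' ->
  act A j (act A' j' x) = act A' j' (act A j x).
Proof.
have [<-|jj'] := eqVneq j j'; first by case=> // AA'; rewrite !act_mul AA'.
move=> _; apply/ffunP => al; rewrite !ffunE.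
transitivity (\sum_k \sum_l A (al j) k * A' (al j') l * x (upd (upd al j k) j' l)).
  apply: eq_bigr => k _; rewrite ffunE mulr_sumr; apply: eq_bigr => l _.
  by rewrite ffunE eq_sym (negbTE jj') mulrA.
rewrite exchange_big/=; apply: eq_bigr => l _.
rewrite ffunE mulr_sumr; apply: eq_bigr => k _.
by rewrite ffunE (negbTE jj') updC// mulrA [A' _ _ * _]mulrC.
Qed.

(* Summing over a coordinate and its replacement at once counts every index
   N+1 times: (al, k) |-> (upd al j k, al j) is an involution. *)
Lemma sum_upd (g : Idx -> C) j :
  \sum_al \sum_k g (upd al j k) = N.+1%:R * \sum_al g al.
Proof.
rewrite pair_big/=.
rewrite (reindex_inj (h := fun p : Idx * 'I_N.+1 => (upd p.1 j p.2, p.1 j)))/=; last first.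
  apply: (can_inj (g := fun p : Idx * 'I_N.+1 => (upd p.1 j p.2, p.1 j))) => -[al k]/=.
  by rewrite upd_upd upd_id updE.
under eq_bigr do rewrite upd_upd upd_id.
rewrite -(pair_bigA _ (fun al k => g al))/= mulr_sumr; apply: eq_bigr => al _.
by rewrite sumr_const card_ord mulr_natl.
Qed.

(** The bound for [A] holds on each fibre where all coordinates but the j-th are fixed. Summing over
    all indices counts every fibre N + 1 times on both sides, whence [sum_upd]. *)
Lemma act_contraction A j x :
  (forall v : 'cV[C]_N.+1, \sum_i `|(A *m v) i 0| ^+ 2 <= \sum_i `|v i 0| ^+ 2) ->
  `|act A j x| <= `|x|.
Proof.
move=> hA; rewrite -(@ler_pXn2r _ 2) ?nnegrE//; rewrite !norm_sqrE.
have N0 : 0 < N.+1%:R :> C by [].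
rewrite -(ler_pM2l N0) -!(sum_upd _ j).
apply: ler_sum => al _.
have := hA (\col_k x (upd al j k)).
rewrite [X in _ <= X -> _](eq_bigr (fun k => `|x (upd al j k)| ^+ 2)); last first.
  by move=> k _; rewrite mxE.
apply: le_trans; rewrite le_eqVlt; apply/orP; left; apply/eqP.
apply: eq_bigr => k _; rewrite ffunE mxE; congr (`|_| ^+ 2).
by apply: eq_bigr => l _; rewrite mxE updE upd_upd.
Qed.

Definition tensor (v : 'I_d -> 'cV[C]_N.+1) : H := [ffun al : Idx => \prod_j v j (al j) 0].

Lemma act_tensor A j v :
  act A j (tensor v) = tensor (fun i => if i == j then A *m v i else v i).
Proof.
apply/ffunP => al; rewrite !ffunE (bigD1 j)//= eqxx mxE mulr_suml.
apply: eq_bigr => k _; rewrite ffunE (bigD1 j)//= updE mulrA; congr (_ * _).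
by apply: eq_bigr => i ij; rewrite ffunE (negbTE ij).
Qed.

Lemma iter_act_tensor A j n v :
  iter n (act A j) (tensor v) = tensor (fun i => if i == j then A ^+ n *m v i else v i).
Proof.
elim: n => [|n IH].
  by congr tensor; apply/funext => i; rewrite expr0 mul1mx; case: eqP.
rewrite iterS IH act_tensor; congr tensor; apply/funext => i.
by case: eqP => // _; rewrite exprS mulmxA.
Qed.

Lemma operator_monomial_tensor (M : 'I_d -> 'M[C]_N.+1) (a : multi_index d) v :
  operator_monomial (fun j => act (M j) j) a (tensor v) =
  tensor (fun j => M j ^+ a j *m v j).
Proof.
rewrite /operator_monomial.
suff key (s : seq 'I_d) : uniq s ->
    (\big[(fun f g => f \o g)/idfun]_(j <- s) iter (a j) (act (M j) j)) (tensor v) =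
    tensor (fun j => if j \in s then M j ^+ a j *m v j else v j).
  rewrite key ?index_enum_uniq//; congr tensor; apply/funext => j.
  by rewrite mem_index_enum.
elim: s => [_|j s IH /= /andP[js us]]; first by rewrite big_nil.
rewrite big_cons /= IH// iter_act_tensor; congr tensor; apply/funext => i.
by rewrite inE; case: (i =P j) => //= ->; rewrite (negbTE js).
Qed.

Definition tensor_basis (ka : Idx) : H := tensor (fun j => delta_mx (ka j) 0).

Lemma tensor_basisE ka al : tensor_basis ka al = (al == ka)%:R.
Proof.
rewrite ffunE; have [->|ne] := eqVneq al ka.
  by rewrite big1// => j _; rewrite mxE !eqxx.
have [j jne] : exists j, al j != ka j.
  apply/existsP; rewrite -negb_forall; apply: contra ne => /forallP h.
  by apply/eqP/ffunP => j; apply/eqP.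
by rewrite (bigD1 j)//= mxE (negbTE jne) mul0r.
Qed.

Lemma operator_monomial_entry (M : 'I_d -> 'M[C]_N.+1) (a : multi_index d) ka nu :
  operator_monomial (fun j => act (M j) j) a (tensor_basis ka) nu =
  \prod_j (M j ^+ a j) (nu j) (ka j).
Proof.
rewrite operator_monomial_tensor ffunE; apply: eq_bigr => j _.
by rewrite -colE mxE.
Qed.

End TensorAction.

(** * The Schur-Agler bound *)

Section Compression.
Context {C : numClosedFieldType}.

(** The matrix with rows (b0, 0) and (b, b0) is a contraction, and one well-chosen vector gives the
    bound. *)
Lemma two_by_two_contraction (b b0 : C) :
  (forall s t : C, `|s * b0| ^+ 2 + `|s * b + t * b0| ^+ 2 <= `|s| ^+ 2 + `|t| ^+ 2) ->
  `|b| <= 1 - `|b0| ^+ 2.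
Proof.
move=> h; set u := 1 - `|b0| ^+ 2.
have u0 : 0 <= u.
  have := h 0 1; rewrite !mul0r mul1r normr0 expr0n/= !add0r normr1 expr1n.
  by rewrite subr_ge0.
have [u_eq0|u_neq0] := eqVneq u 0.
  have b01 : `|b0| ^+ 2 = 1 by apply/esym/eqP; rewrite -subr_eq0 -/u u_eq0.
  (* With |b0| = 1 the second coordinate of the image is 2b, so 1 + 4|b|^2 <= 1 + |b|^2 and b =
     0. *)
  have := h 1 (b0^* * b).
  rewrite !mul1r b01 normr1 expr1n lerD2l normrM norm_conjC exprMn b01 mul1r.
  have -> : b + b0^* * b * b0 = 2 * b.
    by rewrite [b0^* * b]mulrC -mulrA [b0^* * b0]mulrC -normCK b01 mulr1; ring.
  rewrite normrM exprMn normr_nat -subr_le0.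
  have -> : 2 ^+ 2 * `|b| ^+ 2 - `|b| ^+ 2 = 3 * `|b| ^+ 2 :> C by ring.
  rewrite pmulr_rle0// => b2; rewrite u_eq0.
  have : `|b| ^+ 2 == 0 by rewrite eq_le b2 exprn_ge0.
  by rewrite sqrf_eq0 => /eqP ->.
have ugt0 : 0 < u by rewrite lt_def u_neq0.
(* This vector makes the second coordinate of the image equal to b; the inequality becomes |b|^2 u
   <= u^2 u, from which u cancels. *)
have := h u (b0^* * b).
have -> : u * b + b0^* * b * b0 = b by rewrite /u normCK; ring.
rewrite (ger0_norm u0) !normrM norm_conjC (ger0_norm u0) !exprMn => h1.
have h2 : `|b| ^+ 2 * u <= u ^+ 2 * u.
  rewrite -subr_ge0; move: h1; rewrite -subr_ge0.
  by move=> h2; apply: (le_trans h2); rewrite le_eqVlt; apply/orP; left; apply/eqP; rewrite /u; ring.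
by move: h2; rewrite ler_pM2r// ler_pXn2r ?nnegrE.
Qed.

End Compression.

Section OperatorNorm.
Context {R : realType}.

Lemma operator_norm_lt (H : normedModType R[i]) (T : H -> H) (x : H) (e : R) :
  (operator_norm T < e%:E)%E -> `|x| <= 1 -> `|T x| < (e%:C)%C.
Proof.
move=> Te x1.
have : ((complex.Re `|T x|)%:E < e%:E)%E.
  by apply: le_lt_trans Te; apply: ereal_sup_ubound; exists x.
by rewrite lte_fin -ltcR RRe_real// ger0_real.
Qed.

Lemma operator_norm_le1 (H : normedModType R[i]) (T : H -> H) (x : H) :
  (operator_norm T <= 1)%E -> `|x| <= 1 -> `|T x| <= 1.
Proof.
move=> T1 x1.
have : ((complex.Re `|T x|)%:E <= 1)%E.
  by apply: le_trans T1; apply: ereal_sup_ubound; exists x.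
by rewrite lee_fin -lecR RRe_real// ger0_real.
Qed.

Lemma operator_norm_contraction (H : normedModType R[i]) (T : {linear H -> H}) (x : H) :
  (operator_norm T <= 1)%E -> `|T x| <= `|x|.
Proof.
move=> T1; have [->|x0] := eqVneq x 0; first by rewrite linear0.
have nx : 0 < `|x| by rewrite normr_gt0.
have := @operator_norm_le1 _ T (`|x|^-1 *: x) T1.
rewrite linearZ !normrZ normfV normr_id mulVf ?gt_eqF// => /(_ (lexx _)).
by rewrite ler_pdivrMl// mulr1.
Qed.

Lemma contraction_operator_norm (H : normedModType R[i]) (T : H -> H) :
  (forall x, `|T x| <= `|x|) -> (operator_norm T <= 1)%E.
Proof.
move=> hT; apply: ge_ereal_sup => _ [x /= x1 <-].
rewrite lee_fin -lecR RRe_real ?ger0_real//.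
exact: le_trans (hT x) x1.
Qed.

Lemma operator_power_series_apply (d : nat) (c : multi_index d -> R[i])
    (H : normedModType R[i]) (S : 'I_d -> H -> H) (B : H -> H) (x : H) :
  operator_power_series c S B -> `|x| <= 1 ->
  forall e : (R[i] : numFieldType), 0 < e -> exists A : {fset multi_index d}, forall A' : {fset multi_index d},
    (A `<=` A')%fset ->
    `|\sum_(a <- A') c a *: operator_monomial S a x - B x| < e.
Proof.
move=> hS x1 e e0.
have eE := ge0_ReE (ltW e0).
have e0' := gt0_Re e0.
have : nbhs (0%:E : \bar R) [set y | (y < (complex.Re e)%:E)%E].
  change (nbhs (0 : R) [set y | ((y%:E : \bar R) < (complex.Re e)%:E)%E]).
  by near=> y; rewrite /= lte_fin; near: y; apply: lt_nbhsl.
move=> /hS [A _ hA]; exists A => A' AA'.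
have := operator_norm_lt (hA A' AA') x1.
by rewrite partial_sumE -eE.
Unshelve. all: by end_near. Qed.

End OperatorNorm.

Section SchurAglerBound.
Context {R : realType} {d : nat}.
Local Notation C := (R[i] : numClosedFieldType).
Context {phi : 'rV[R[i]]_d -> R[i]} {c : multi_index d -> R[i]}.
Context (phi_SA : schur_agler phi) (phi_c : power_series_at phi 0 c).

Lemma norm_tensor_basis N (ka : {ffun 'I_d -> 'I_N.+1}) : `|tensor_basis ka : l2 R _| = 1.
Proof.
apply/eqP; rewrite -(@eqrXn2 _ 2)// norm_sqrE expr1n (bigD1 ka)//= tensor_basisE eqxx.
rewrite normr1 expr1n big1 ?addr0// => al alka.
by rewrite tensor_basisE (negbTE alka) normr0 expr0n.
Qed.

(** An entry of a vector is bounded by its norm, so the norm limit [B] can be read off entry by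
    entry as convergent scalar series. *)
Lemma schur_agler_operator N (z : 'rV[C]_d) (r : R) :
  (forall j, `|z 0 j| <= 1) -> 0 < r < 1 ->
  exists B : {linear l2 R {ffun 'I_d -> 'I_N.+1} -> l2 R {ffun 'I_d -> 'I_N.+1}},
    (forall x, `|B x| <= `|x|) /\
    forall ka nu : {ffun 'I_d -> 'I_N.+1}, has_sum (fun a => c a *
        \prod_j (((r%:C)%C *: mobius_shift (z 0 j)) ^+ a j) (nu j) (ka j))
      (B (tensor_basis ka) nu).
Proof.
move=> z1 r01.
set H := l2 R {ffun 'I_d -> 'I_N.+1}.
pose T j : {linear H -> H} := act (mobius_shift (z 0 j)) j.
have T1 j : (operator_norm (T j) <= 1)%E.
  apply: contraction_operator_norm => x; apply: act_contraction => v.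
  exact: mobius_shift_contraction.
have Tcomm j k x : T j (T k x) = T k (T j x).
  apply: act_comm; have [->|] := eqVneq j k; [by left | by right].
have [_ hSA] := phi_SA.
have [B [hB B1]] := hSA c phi_c H (@l2_dot R _) (@l2_norm_dot R _) T T1 Tcomm r r01.
exists B; split; first by move=> x; apply: operator_norm_contraction.
move=> ka nu e e0.
have [|A hA] := operator_power_series_apply (x := tensor_basis ka) hB _ e0.
  by rewrite norm_tensor_basis.
exists A => A' AA'; rewrite distrC; apply: le_lt_trans (hA A' AA').
apply: le_trans (coord_norm_le _ nu).
rewrite le_eqVlt; apply/orP; left; apply/eqP; congr `|_|.
rewrite !ffunE sum_ffunE; congr (_ - _); apply: eq_bigr => a _.
(* Absorbing r into the matrix makes r T_j again an action on one tensor factor. *)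
have TE : (fun j (x : H) => (r%:C)%C *: T j x) =
    (fun j => act ((r%:C)%C *: mobius_shift (z 0 j)) j).
  apply/funext => j; apply/funext => x; apply/ffunP => al.
  rewrite !ffunE scaler_sumr; apply: eq_bigr => k _.
  by rewrite [in RHS]mxE; apply: mulrA.
by rewrite ffunE TE operator_monomial_entry.
Qed.

(* The compression of B to the span of e_ka and e_nu is lower triangular with
   constant diagonal. *)
Lemma offdiag_entry_le N (z : 'rV[C]_d) (r : R)
    (B : {linear l2 R {ffun 'I_d -> 'I_N.+1} -> l2 R {ffun 'I_d -> 'I_N.+1}}) (s : C)
    (ka nu : {ffun 'I_d -> 'I_N.+1}) j :
  (forall x, `|B x| <= `|x|) ->
  (forall ka nu : {ffun 'I_d -> 'I_N.+1}, has_sum (fun a => c a *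
        \prod_j (((r%:C)%C *: mobius_shift (z 0 j)) ^+ a j) (nu j) (ka j))
      (B (tensor_basis ka) nu)) ->
  has_sum (fun a => c a * monomial ((r%:C)%C *: z) a) s ->
  (ka j < nu j)%N -> `|B (tensor_basis ka) nu| <= 1 - `|s| ^+ 2.
Proof.
move=> B1 hB hs jlt.
have diag al : B (tensor_basis al) al = s.
  apply: (has_sum_unique (hB al al)); apply: eq_has_sum hs => a.
  congr (_ * _); apply: eq_bigr => i _.
  by rewrite scale_mobius_shift_exp_diag mxE.
have upper : B (tensor_basis nu) ka = 0.
  apply: (has_sum_unique (hB nu ka)); apply: eq_has_sum has_sum0 => a.
  apply/esym/eqP; rewrite mulf_eq0; apply/orP; right.
  by apply/prodf_eq0; exists j => //; rewrite scale_mobius_shift_exp_upper.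
have kanu : ka != nu by apply: contraTneq jlt => ->; rewrite ltnn.
apply: two_by_two_contraction => s1 t1.
pose x : l2 R _ := s1 *: tensor_basis ka + t1 *: tensor_basis nu.
have xv al : x al = s1 * (al == ka)%:R + t1 * (al == nu)%:R.
  rewrite -!tensor_basisE [LHS]ffunE.
  by congr (_ + _); rewrite [LHS]ffunE.
have xE : `|x| ^+ 2 = `|s1| ^+ 2 + `|t1| ^+ 2.
  rewrite norm_sqrE (bigD1 ka)//= (bigD1 nu) 1?eq_sym//= big1 ?addr0; last first.
    move=> al /andP[alka alnu]; rewrite xv (negbTE alka) (negbTE alnu).
    by rewrite !mulr0 addr0 normr0 expr0n.
  rewrite !xv !eqxx [nu == ka]eq_sym (negbTE kanu) !mulr0 addr0 add0r.
  by rewrite !mulr1.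
have Bx al : B x al = s1 * B (tensor_basis ka) al + t1 * B (tensor_basis nu) al.
  rewrite linearD !linearZ [LHS]ffunE.
  by congr (_ + _); rewrite [LHS]ffunE.
have := B1 x; rewrite -(@ler_pXn2r _ 2) ?nnegrE//; rewrite xE; apply: le_trans.
rewrite norm_sqrE (bigD1 ka)//= (bigD1 nu) 1?eq_sym//= !Bx !diag upper mulr0 addr0.
by rewrite addrA lerDl sumr_ge0// => al _; rewrite exprn_ge0.
Qed.

Lemma schur_agler_abs_cvg : abs_cvg_ball c 1.
Proof.
move=> w w1.
have wE := ge0_ReE (normr_ge0 w).
have w1R : complex.Re `|w| < 1 by rewrite -ltcR -wE.
have [r /andP[wr r1]] : exists r : R, complex.Re `|w| < r < 1.
  by exists ((complex.Re `|w| + 1) / 2); rewrite midf_lt//= midf_lt.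
have w0 : 0 <= complex.Re `|w| by rewrite -ler0c -wE normr_ge0.
have r0 : 0 < r := le_lt_trans w0 wr.
have rC : (r%:C)%C != 0 :> C by rewrite gt_eqF// ltcR.
pose z : 'rV[C]_d := (r%:C)%C^-1 *: w.
have z1 j : `|z 0 j| <= 1.
  have rC0 : 0 < (r%:C)%C :> C by rewrite ltcR.
  rewrite mxE normrM normfV (ger0_norm (ltW rC0)) ler_pdivrMl// mulr1.
  by rewrite (le_trans (row_norm_ge w j))// wE lecR ltW.
have zE j : (r%:C)%C * z 0 j = w 0 j by rewrite mxE mulrA mulfV// mul1r.
have r01 : 0 < r < 1 by rewrite r0.
(* For one-by-one matrices the shift is 0 and [mobius_shift] is the scalar z_j, so the single entry
   of the operator series is the series of [phi] at r z = w. *)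
have [B [_ hB]] := schur_agler_operator 0 z1 r01.
have := has_sum_abs_cvg (hB [ffun=> 0] [ffun=> 0]).
congr abs_cvg; apply/funext => a; congr (_ * _); apply: eq_bigr => j _.
by rewrite !ffunE scale_mobius_shift_exp_diag zE.
Qed.

(** Weighting row [nu] of [B] by [u] isolates the coefficient, with one factor r (1 - |z_j|^2) per
    derivative in z_j; the triangle inequality then costs the l1 norm of the weights. *)
Lemma schur_agler_taylor_le (z : 'rV[C]_d) (r : R) (n : multi_index d) :
  (forall j, `|z 0 j| < 1) -> 0 < r < 1 -> (exists j, n j <> 0%N) ->
  `|taylor_coef c n ((r%:C)%C *: z)| *
     \prod_j ((r%:C)%C * (1 - `|z 0 j| ^+ 2)) ^+ n j <=
  \prod_j (1 + `|z 0 j|) ^+ (n j).-1 *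
    (1 - `|taylor_coef c [ffun=> 0%N] ((r%:C)%C *: z)| ^+ 2).
Proof.
move=> z1 r01 [j0 nj0].
have rz1 : `|(r%:C)%C *: z| < 1.
  apply/row_norm_ltP; split=> // j; rewrite mxE normrM.
  have r0c : 0 <= (r%:C)%C :> C by rewrite ler0c ltW//; case/andP: r01.
  rewrite (ger0_norm r0c) mulr_ilt1//.
  by rewrite ltc1; case/andP: r01.
pose N := (\sum_j n j)%N.
have nN j : (n j < N.+1)%N by rewrite ltnS /N (bigD1 j)//= leq_addr.
have [B [B1 hB]] := schur_agler_operator N (fun j => ltW (z1 j)) r01.
pose nu : {ffun 'I_d -> 'I_N.+1} := [ffun j => inord (n j)].
have nuE j : nu j = n j :> nat by rewrite ffunE inordK.
pose u (ka : {ffun 'I_d -> 'I_N.+1}) : C :=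
  \prod_j (mobius_den (z 0 j) ^+ (n j).-1) (ka j) 0.
set F := taylor_coef c [ffun=> 0%N] _.
set E := taylor_coef c n _.
have hs : has_sum (fun a => c a * monomial ((r%:C)%C *: z) a) F.
  apply: eq_has_sum (has_sum_taylor [ffun=> 0%N] schur_agler_abs_cvg rz1) => a.
  by rewrite bin_monomial0.
(* For each exponent a, the sum over [ka] factors into one sum per variable, evaluated by
   [mobius_shift_exp_den]. *)
have combo : E * \prod_j ((r%:C)%C * (1 - `|z 0 j| ^+ 2)) ^+ n j =
    \sum_ka u ka * B (tensor_basis ka) nu.
  have h1 := has_sum_sum (index_enum {ffun 'I_d -> 'I_N.+1})
    (fun ka => has_sumZ (u ka) (hB ka nu)).
  have h2 := has_sumZ (\prod_j ((r%:C)%C * (1 - `|z 0 j| ^+ 2)) ^+ n j)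
    (has_sum_taylor n schur_agler_abs_cvg rz1).
  rewrite mulrC; apply: (has_sum_unique h2); apply: eq_has_sum h1 => a.
  transitivity (c a * \sum_(ka : {ffun 'I_d -> 'I_N.+1}) \prod_j
     ((((r%:C)%C *: mobius_shift (z 0 j)) ^+ a j) (nu j) (ka j) *
       (mobius_den (z 0 j) ^+ (n j).-1) (ka j) 0)).
    rewrite mulr_sumr; apply: eq_bigr => ka _.
    by rewrite mulrCA big_split/=; congr (_ * _); rewrite mulrC.
  rewrite mulrCA; congr (_ * _).
  rewrite -(bigA_distr_bigA (fun j k =>
    (((r%:C)%C *: mobius_shift (z 0 j)) ^+ a j) (nu j) k *
       (mobius_den (z 0 j) ^+ (n j).-1) k 0)).
  rewrite -big_split/=; apply: eq_bigr => j _.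
  transitivity ((r%:C)%C ^+ a j *
      (mobius_shift (z 0 j) ^+ a j *m mobius_den (z 0 j) ^+ (nu j).-1) (nu j) 0).
    rewrite mxE mulr_sumr nuE; apply: eq_bigr => k _.
    by rewrite exprZn mxE mulrA.
  rewrite mobius_shift_exp_den nuE mxE.
  have [an|na] := ltnP (a j) (n j); first by rewrite bin_small// !(mul0r, mulr0).
  rewrite -{1}(subnK na) exprD !exprMn.
  by rewrite !mulrA; ring.
have n_gt0 : (0 < n j0)%N by rewrite lt0n; apply/eqP.
(* The entry from the zero index to [nu] is strictly off the diagonal, so its modulus lies between 0
   and this quantity. *)
have D0 : 0 <= 1 - `|F| ^+ 2.
  have lt0 : (([ffun=> ord0] : {ffun 'I_d -> 'I_N.+1}) j0 < nu j0)%N.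
    by rewrite ffunE nuE.
  exact: le_trans (normr_ge0 _) (offdiag_entry_le B1 hB hs lt0).
have P0 : 0 <= \prod_j ((r%:C)%C * (1 - `|z 0 j| ^+ 2)) ^+ n j :> C.
  apply: prodr_ge0 => j _; rewrite exprn_ge0// mulr_ge0//.
    by rewrite ler0c ltW//; case/andP: r01.
  by rewrite subr_ge0 expr_le1// ltW.
rewrite -(ger0_norm P0) -normrM combo.
apply: (@le_trans _ _ (\sum_ka `|u ka| * (1 - `|F| ^+ 2))).
  apply: le_trans (ler_norm_sum _ _ _) _; apply: ler_sum => ka _.
  (* Columns with ka j0 >= n j0 have weight 0, because the j0-th power of den has degree n j0 - 1;
     all others fall under the off-diagonal bound. *)
  rewrite normrM; have [lt|ge] := ltnP (ka j0) (nu j0).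
    by rewrite ler_wpM2l// (offdiag_entry_le B1 hB hs lt).
  have -> : u ka = 0; last by rewrite normr0 !mul0r.
  apply/eqP/prodf_eq0; exists j0 => //; rewrite upper_band_den_exp//.
  by rewrite (leq_trans _ ge)// nuE prednK.
rewrite -mulr_suml ler_wpM2r//.
have uE ka : `|u ka| = \prod_j `|(mobius_den (z 0 j) ^+ (n j).-1) (ka j) 0|.
  exact: normr_prod.
rewrite (eq_bigr _ (fun ka _ => uE ka)).
rewrite -(bigA_distr_bigA (fun j k => `|(mobius_den (z 0 j) ^+ (n j).-1) k 0|)).
apply: ler_prod => j _; rewrite sumr_ge0//=.
exact: sum_den_exp_le.
Qed.

End SchurAglerBound.

(** * Comparison of the disc factors and the limit r -> 1 *)

Lemma prod_disc_factors_le (K : numFieldType) (d : nat) (n : multi_index d)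
    (t : 'I_d -> K) (tau : K) j0 :
  (0 < n j0)%N -> (forall j, 0 <= t j <= tau) -> tau < 1 ->
  (1 - tau ^+ 2) * (1 - tau) ^+ (\sum_j n j).-1 * \prod_j (1 + t j) ^+ (n j).-1 <=
  \prod_j (1 - t j ^+ 2) ^+ n j.
Proof.
move=> n0 t01 tau1.
have t0 j : 0 <= t j by case/andP: (t01 j).
have tt j : t j <= tau by case/andP: (t01 j).
have tau0 : 0 <= tau := le_trans (t0 j0) (tt j0).
have u0 : 0 <= 1 - tau by rewrite subr_ge0 ltW.
have v0 : 0 <= 1 - tau ^+ 2 by rewrite subr_ge0 expr_le1// ltW.
have ut j : 1 - tau <= 1 - t j by rewrite lerD2l lerN2.
have vt j : 1 - tau ^+ 2 <= 1 - t j ^+ 2 by rewrite lerD2l lerN2 lerXn2r ?nnegrE.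
(* What is left of (1 - t_j^2)^(n_j) after taking out (1 + t_j)^(n_j - 1). For n_j = 0 the truncated
   exponent takes out nothing, so the value is 1. *)
pose g j : K := if n j == 0%N then 1 else (1 - t j ^+ 2) * (1 - t j) ^+ (n j).-1.
have -> : \prod_j (1 - t j ^+ 2) ^+ n j = \prod_j g j * \prod_j (1 + t j) ^+ (n j).-1.
  rewrite -big_split/=; apply: eq_bigr => j _; rewrite /g.
  case: (n j) => [|m]/=; first by rewrite mulr1.
  rewrite -mulrA -exprMn exprS; congr (_ * _ ^+ m); ring.
apply: ler_wpM2r; first by apply: prodr_ge0 => j _; rewrite exprn_ge0// addr_ge0 ?t0.
have -> : (\sum_j n j).-1 = ((n j0).-1 + \sum_(j | j != j0) n j)%N.
  by rewrite (bigD1 j0)//= -[in LHS](prednK n0) addSn.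
(* The variable j0 supplies 1 - tau^2 and n_j0 - 1 factors 1 - tau; any other variable supplies n_j
   such factors, since 1 - t^2 >= 1 - t. *)
rewrite exprD mulrA (bigD1 j0 (F := g))//=; apply: ler_pM.
- by rewrite mulr_ge0// exprn_ge0.
- by rewrite exprn_ge0.
- rewrite /g gtn_eqF//; apply: ler_pM => //; first by rewrite exprn_ge0.
  by apply: lerXn2r => //; rewrite nnegrE// (le_trans u0).
rewrite -prodrXr; apply: ler_prod => j _; rewrite exprn_ge0//= /g.
case: (n j) => [|m]/=; first by rewrite expr0.
have t1 : 0 <= 1 - t j := le_trans u0 (ut j).
rewrite exprS; apply: ler_pM; rewrite ?exprn_ge0//.
  apply: le_trans (ut j) _.
  by rewrite -subr_ge0 (_ : _ - _ = t j * (1 - t j)) ?mulr_ge0//; ring.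
by apply: lerXn2r; rewrite ?nnegrE.
Qed.

Lemma horner_ge0_left (R : realType) (p : {poly R}) (s : R) : s < 1 ->
  (forall r, s < r -> r < 1 -> 0 <= p.[r]) -> 0 <= p.[1].
Proof.
move=> s1 hp; rewrite leNgt; apply/negP => p1.
have h1 : \forall x \near (1 : R)^'-, p.[x] < 0.
  have h := cvg_at_left_filter (@continuous_horner R p 1).
  exact: (cvgr_lt p.[1] h).
near (1 : R)^'- => x.
have : 0 <= p.[x].
  by apply: hp; [near: x; exact: nbhs_left_gt | near: x; exact: nbhs_left_lt].
by apply/negP; rewrite -ltNge; near: x.
Unshelve. all: by end_near. Qed.

(** All quantities are nonnegative, hence real, so the bounds say that a real polynomial in r is
    nonnegative to the left of 1; by continuity it is so at 1. *)
Lemma le_of_radial_bounds (R : realType) (m : nat) (x y w : R[i]) :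
  0 <= x -> 0 <= y -> 0 <= w -> y < 1 ->
  (forall r : R, y < (r%:C)%C -> r < 1 ->
    x * (((r%:C)%C ^+ 2 - y ^+ 2) * ((r%:C)%C - y) ^+ m) <=
    (1 - w ^+ 2) * (r%:C)%C) ->
  x * ((1 - y ^+ 2) * (1 - y) ^+ m) <= 1 - w ^+ 2.
Proof.
move=> /ge0_ReE -> /ge0_ReE -> /ge0_ReE ->.
move: (complex.Re x) (complex.Re y) (complex.Re w) => t s f {x y w}.
rewrite ltc1 => s1 key.
pose p : {poly R} := (1 - f ^+ 2) *: 'X -
   t *: (('X ^+ 2 - (s ^+ 2)%:P) * ('X - s%:P) ^+ m).
have pE r : p.[r] = (1 - f ^+ 2) * r - t * ((r ^+ 2 - s ^+ 2) * (r - s) ^+ m).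
  by rewrite /p !hornerE.
have : 0 <= p.[1].
  apply: (horner_ge0_left s1) => r sr r1.
  have := key r; rewrite ltcR => /(_ sr r1).
  rewrite pE subr_ge0 -lecR.
  by rewrite !(rmorphM, rmorphB, rmorphXn, rmorph1).
rewrite pE expr1n mulr1 subr_ge0 -lecR.
by rewrite !(rmorphM, rmorphB, rmorphXn, rmorph1).
Qed.

Section LimitInequality.
Context {R : realType} {d : nat}.
Local Notation C := (R[i] : numClosedFieldType).

Lemma schur_agler_coef_le (phi : 'rV[R[i]]_d -> R[i]) (c : multi_index d -> R[i])
    (z : 'rV[R[i]]_d) (n : multi_index d) :
  schur_agler phi -> power_series_at phi 0 c -> `|z| < 1 ->
  (exists j, n j <> 0%N) ->
  `|taylor_coef c n z| * ((1 - `|z| ^+ 2) * (1 - `|z|) ^+ (\sum_j n j).-1) <=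
  1 - `|taylor_coef c [ffun=> 0%N] z| ^+ 2.
Proof.
move=> phi_SA phi_c z1 hn; have [j0 nj0] := hn.
have n0 : (0 < n j0)%N by rewrite lt0n; apply/eqP.
set m := (\sum_j n j)%N; set T := taylor_coef c n z.
set F := taylor_coef c _ z.
have key (r : R) : `|z| < (r%:C)%C -> r < 1 ->
   `|T| * (((r%:C)%C ^+ 2 - `|z| ^+ 2) * ((r%:C)%C - `|z|) ^+ m.-1) <=
   (1 - `|F| ^+ 2) * (r%:C)%C.
  move=> zr r1; set q : C := (r%:C)%C.
  have q0 : 0 < q := le_lt_trans (normr_ge0 z) zr.
  have qn0 : q != 0 by rewrite gt_eqF.
  have r0 : 0 < r by rewrite -ltcR.
  have r01 : 0 < r < 1 by rewrite r0.
  pose w : 'rV[C]_d := q^-1 *: z.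
  have qw : q *: w = z by rewrite scalerA mulfV// scale1r.
  have wz j : `|w 0 j| <= `|z| / q.
    by rewrite mxE normrM normfV (gtr0_norm q0) ler_pdivlMr// mulrAC mulVf// mul1r row_norm_ge.
  have zq1 : `|z| / q < 1 by rewrite ltr_pdivrMr// mul1r.
  have w1 j : `|w 0 j| < 1 := le_lt_trans (wz j) zq1.
  have := schur_agler_taylor_le phi_SA phi_c w1 r01 hn.
  rewrite -/q qw -/T -/F => h.
  have D0 : 0 <= 1 - `|F| ^+ 2.
    have P0 : 0 < \prod_j (1 + `|w 0 j|) ^+ (n j).-1 :> C.
      by apply: prodr_gt0 => j _; rewrite exprn_gt0// ltr_pwDl.
    rewrite -(pmulr_rge0 _ P0); apply: le_trans h.
    apply: mulr_ge0 => //; apply: prodr_ge0 => j _; rewrite exprn_ge0// mulr_ge0 ?(ltW q0)//.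
    by rewrite subr_ge0 expr_le1// ltW.
  have pf := prod_disc_factors_le (t := fun j => `|w 0 j|) n0
    (fun j => introT andP (conj (normr_ge0 (w 0 j)) (wz j))) zq1.
  have P0 : 0 < \prod_j (1 + `|w 0 j|) ^+ (n j).-1 :> C.
    by apply: prodr_gt0 => j _; rewrite exprn_gt0// ltr_pwDl.
  have Eq : \prod_j (q * (1 - `|w 0 j| ^+ 2)) ^+ n j =
      q ^+ m * \prod_j (1 - `|w 0 j| ^+ 2) ^+ n j.
    by rewrite -prodrXr -big_split/=; apply: eq_bigr => j _; rewrite exprMn.
  rewrite Eq in h.
  have h2 : `|T| * (q ^+ m * ((1 - (`|z| / q) ^+ 2) * (1 - `|z| / q) ^+ m.-1)) <=
      1 - `|F| ^+ 2.
    rewrite -(ler_pM2r P0) [leRHS]mulrC; apply: le_trans h.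
    rewrite -!mulrA ler_wpM2l// ler_wpM2l ?exprn_ge0 ?(ltW q0)//.
    by rewrite mulrA.
  (* Clearing denominators in |z| / q takes q^2 q^(m - 1), one power more than the q^m present;
     multiplying by q makes the inequality polynomial. *)
  rewrite -(ler_pM2r q0) in h2; apply: le_trans h2.
  rewrite le_eqVlt; apply/orP; left; apply/eqP.
  have -> : m = m.-1.+1 by rewrite prednK// /m (bigD1 j0)//= ltn_addr.
  rewrite /= -mulrA; congr (_ * _).
  have -> : q - `|z| = q * (1 - `|z| / q) by rewrite mulrBr mulr1 mulrCA mulfV// mulr1.
  rewrite exprMn.
  have -> : q ^+ 2 - `|z| ^+ 2 = q ^+ 2 * (1 - (`|z| / q) ^+ 2).
    by rewrite mulrBr mulr1 -exprMn mulrCA mulfV// mulr1.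
  rewrite [q ^+ m.-1.+1]exprS; move: (1 - (`|z| / q) ^+ 2) ((1 - `|z| / q) ^+ m.-1) (q ^+ m.-1) => a b e.
  by ring.
exact: (le_of_radial_bounds (normr_ge0 T) (normr_ge0 z) (normr_ge0 F) z1 key).
Qed.

End LimitInequality.

Theorem theorem7 (R : realType) (d : nat) (d_gt0 : (0 < d)%N)
    (phi : 'rV[R[i]]_d -> R[i]) (phi_SA : schur_agler phi)
    (z : 'rV[R[i]]_d) (z_in : polydisk R[i] d z)
    (n : multi_index d) (n_neq0 : exists j, n j <> 0%N) :
  `|mixed_derivative n phi z| <=
    (\prod_(j < d) (n j)`!)%:R *
    ((1 - `|phi z| ^+ 2) /
      ((1 - `|z| ^+ 2) * (1 - `|z|) ^+ (\sum_(j < d) n j).-1)).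
Proof.
have z1 : `|z| < 1 by apply/row_norm_ltP; split=> // j; apply: z_in.
have [phi_an _] := phi_SA.
have [c phi_c] : exists c, power_series_at phi 0 c.
  by apply: phi_an => j; rewrite mxE normr0.
have c1 := schur_agler_abs_cvg phi_SA phi_c.
have phiE := identity_theorem phi_an phi_c c1.
have fE w : `|w| < 1 -> phi (0 + w) = taylor_coef c [ffun=> 0%N] w.
  by move=> w1; rewrite add0r phiE.
rewrite -[z in mixed_derivative _ _ z]add0r (mixed_derivative_taylor n c1 fE z1).
rewrite (phiE z z1) normrM normr_nat; apply: ler_wpM2l; first exact: ler0n.
rewrite ler_pdivlMr; first exact: schur_agler_coef_le phi_SA phi_c z1 n_neq0.
by rewrite mulr_gt0 ?exprn_gt0 ?subr_gt0// expr_lt1.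
Qed.
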